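(* Consider the linear model $y=X\beta^*+\varepsilon$ with random sub-Gaussian design, where $\beta^*\in\mathcal{S}(k,q_1,q_2,R_1,R_2)$. Assume that $X$ is a row-wise $(\sigma_x,\Sigma_x)$-sub-Gaussian random matrix whose covariance $\Sigma_x$ has all eigenvalues in $[c,c']$ for constants $0<c\le c'$ not depending on the dimensions. Let $\lambda\asymp\sigma_\varepsilon\sqrt{\frac{\log n}{N}}$ and $\lambda_g=2^{-(1+k/2)}d^{-(k+1)/2}\lambda$, where $d$ is the maximum degree of the underlying graph. Furthermore, assume that $$R_1\left(\frac{\log n}{N}\right)^{1-\frac{q_1}2}+R_2\left(\frac{\log n}{N}\right)^{1-\frac{q_2}2}\lesssim1 .$$ Let $\hat\beta$ be the $k$-th order Graph-Piecewise-Polynomial-Lasso with tuning parameters $\lambda,\lambda_g$. (a) Then $$\|\hat\beta-\beta^*\|_2^2\le\mathcal{O}_{\mathbb{P}}\left(\sigma_\varepsilon^2\left(R_1\left(\frac{\log n}{N}\right)^{1-\frac{q_1}2}+R_2\left(\frac{\log n}{N}\right)^{1-\frac{q_2}2}\right)\right)$$ and $$\frac1N\|X(\hat\beta-\beta^* )\|_2^2\le\mathcal{O}_{\mathbb{P}}\left(\sigma_\varepsilon^2\left(R_1\left(\frac{\log n}{N}\right)^{1-\frac{q_1}2}+R_2\left(\frac{\log n}{N}\right)^{1-\frac{q_2}2}\right)\right).$$ (b) Moreover, $$\|\hat\beta-\beta^*\|_1^2\le\mathcal{O}_{\mathbb{P}}\left(\sigma_\varepsilon^2\left(R_1^2\left(\frac{\log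 n}{N}\right)^{1-q_1}+R_2^2\left(\frac{\log n}{N}\right)^{1-q_2}\right)\right).$$
   Context: Graph: $\mathcal{G}=(\mathcal{V},\mathcal{E})$ is a known undirected graph with $n$ nodes labelled $1,\dots,n$, $p$ edges, and maximum degree $d$. Its oriented incidence matrix $F\in\{-1,0,1\}^{p\times n}$ has, for the row corresponding to the edge $(i,j)$ with $i<j$, entry $-1$ in position $i$, $+1$ in position $j$, and $0$ elsewhere. The Laplacian is $L=F^TF$. Graph difference operators: $\Delta^{(1)}=F$, and for $k\ge1$, $\Delta^{(k+1)}=F^T\Delta^{(k)}=L^{(k+1)/2}$ if $k$ is odd, $\Delta^{(k+1)}=F\Delta^{(k)}=FL^{k/2}$ if $k$ is even. $k\ge0$ is a fixed integer and $m$ is the number of rows of $\Delta^{(k+1)}$ ($m=n$ for odd $k$, $m=p$ for even $k$). Parameter space: for $k\ge0$, $0<q_1<1$, $0<q_2<1$, $R_1>0$, $R_2>0$, $$\mathcal{S}(k,q_1,q_2,R_1,R_2)=\left\{\beta\in\mathbb{R}^n:\ \sum_{i=1}^m\left|(\Delta_i^{(k+1)})^T\beta\right|^{q_1}\le R_1,\ \sum_{i=1}^n|\beta_i|^{q_2}\le R_2\right\},$$ where $(\Delta_i^{(k+1)})^T$ is the $i$-th row of $\Delta^{(k+1)}$. Model: $X\in\mathbb{R}^{N\times n}$, $y\in\mathbb{R}^N$; the components of $\varepsilon\in\mathbb{R}^N$ are i.i.d. $\sigma_\varepsilon$-sub-Gaussian, and $\varepsilon$ is independent of $X$. A random variable $Z$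 is $\sigma$-sub-Gaussian if $\mathbb{E}Z=0$ and $\mathbb{E}e^{tZ}\le e^{\sigma^2t^2/2}$ for all $t\in\mathbb{R}$; a random vector $Z$ is $\sigma$-sub-Gaussian if $\mathbb{E}Z=0$ and $u^TZ$ is $\sigma$-sub-Gaussian for every unit vector $u$. $X$ is a row-wise $(\sigma_x,\Sigma_x)$-sub-Gaussian random matrix if its rows are i.i.d. from a $\sigma_x$-sub-Gaussian distribution with covariance matrix $\Sigma_x$. Estimator: the $k$-th order Graph-Piecewise-Polynomial-Lasso is $$\hat\beta\in\arg\min_{\beta\in\mathbb{R}^n}\ \frac1{2N}\|y-X\beta\|_2^2+\lambda_g\|\Delta^{(k+1)}\beta\|_1+\lambda\|\beta\|_1 .$$ Asymptotics: $N,n,p$ (and the graph, $R_1,R_2$) may vary and grow; $k,q_1,q_2,\sigma_\varepsilon,\sigma_x$ and the eigenvalue bounds are fixed. $f\lesssim g$ means $f\le Cg$ for some constant $C\in(0,\infty)$, and $f\asymp g$ means $f\lesssim g$ and $g\lesssim f$; the choice $\lambda\asymp g$ means that $\lambda$ is taken to be $g$ times a suitable positive constant. ''$Z\le\mathcal{O}_{\mathbb{P}}(a)$'' means that $Z/a$ is stochastically bounded. *)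

(* Defs.v *)
From HB Require Import structures.
From mathcomp Require Import all_boot all_order all_algebra.
From mathcomp Require Import all_classical all_reals all_analysis.

Set Implicit Arguments.
Unset Strict Implicit.
Unset Printing Implicit Defensive.

Import Order.TTheory GRing.Theory Num.Theory.
Import numFieldNormedType.Exports.

Local Open Scope classical_set_scope.
Local Open Scope ring_scope.

Section vector_norms.
Context {R : realType}.

(* Explicit because the library norm on matrices is the sup norm. *)
Definition l1norm m (v : 'cV[R]_m) : R := \sum_(i < m) `|v i 0|.
Definition sq_l2norm m (v : 'cV[R]_m) : R := \sum_(i < m) v i 0 ^+ 2.

End vector_norms.

Record sgraph (n : nat) := SGraph {
  adj :> rel 'I_n ;
  adj_sym : symmetric adj ;
  adj_irrefl : irreflexive adj }.

Section graph.
Context {R : realType} {n : nat}.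
Variable G : sgraph n.

(* Each undirected edge is represented once, by its pair (i, j) with i < j. *)
Definition edges : {set 'I_n * 'I_n} :=
  [set e : 'I_n * 'I_n | (e.1 < e.2)%N && G e.1 e.2]%SET.

Definition maxdeg : nat := \max_(i < n) #|[pred j | G i j]|.

Definition incidence : 'M[R]_(#|edges|, n) :=
  \matrix_(r, j) (if j == (enum_val r).1 then -1
                  else if j == (enum_val r).2 then 1 else 0).

Definition gdiff_rows (k : nat) : nat := if odd k then n else #|edges|.

Definition gdiff_step (b : bool) :
    'M[R]_(if b then n else #|edges|, n) ->
    'M[R]_(if ~~ b then n else #|edges|, n) :=
  if b return 'M[R]_(if b then n else #|edges|, n) ->
              'M[R]_(if ~~ b then n else #|edges|, n)
  then fun A => incidence *m A
  else fun A => incidence^T *m A.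

(* Index shift: [gdiff k] is the difference operator of order k + 1, so that
   [gdiff 0 = F], [gdiff 1 = F^T F], [gdiff 2 = F F^T F], and so on. *)
Fixpoint gdiff (k : nat) : 'M[R]_(gdiff_rows k, n) :=
  if k is k'.+1 then gdiff_step (gdiff k') else incidence.

Definition param_space (k : nat) (q1 q2 R1 R2 : R) : set 'cV[R]_n :=
  [set b | \sum_(i < gdiff_rows k) `|(gdiff k *m b) i 0| `^ q1 <= R1 /\
           \sum_(i < n) `|b i 0| `^ q2 <= R2].

Definition lasso_objective (k N : nat) (X : 'M[R]_(N, n)) (y : 'cV[R]_N)
    (lam_g lam : R) (b : 'cV[R]_n) : R :=
  (2 * N%:R)^-1 * sq_l2norm (y - X *m b)
  + lam_g * l1norm (gdiff k *m b) + lam * l1norm b.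

Definition lasso_argmin (k N : nat) (X : 'M[R]_(N, n)) (y : 'cV[R]_N)
    (lam_g lam : R) : set 'cV[R]_n :=
  [set b | forall b' : 'cV[R]_n,
     lasso_objective k X y lam_g lam b <= lasso_objective k X y lam_g lam b'].

(* On an edgeless graph the power of [maxdeg = 0] below is the library's
   [0 `^ x = 0]; every difference operator is then zero, so the value of this
   tuning parameter is irrelevant. *)
Definition graph_tuning (k : nat) (lam : R) : R :=
  2 `^ (- (1 + k%:R / 2)) * maxdeg%:R `^ (- (k.+1%:R / 2)) * lam.

End graph.

Definition measure_mx_display : measure_display -> measure_display.
Proof. exact. Qed.

(* Matrices carry the product sigma-algebra, as tuples do in the library; for
   real entries this is the Borel sigma-algebra. *)
Section measurable_matrix.
Context {d} {T : measurableType d} {m n : nat}.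

Definition mx_measurable : set (set 'M[T]_(m, n)) :=
  <<s \bigcup_(ij in [set: 'I_m * 'I_n])
        preimage_set_system [set: 'M[T]_(m, n)]
          (fun A : 'M[T]_(m, n) => A ij.1 ij.2) measurable >>.

Let mx_set0 : mx_measurable set0.
Proof. exact: sigma_algebra0. Qed.

Let mx_setC A : mx_measurable A -> mx_measurable (~` A).
Proof. exact: sigma_algebraC. Qed.

Let mx_bigcup (F : (set 'M[T]_(m, n))^nat) : (forall i, mx_measurable (F i)) ->
  mx_measurable (\bigcup_i F i).
Proof. exact: sigma_algebra_bigcup. Qed.

HB.instance Definition _ := @isMeasurable.Build (measure_mx_display d)
  'M[T]_(m, n) mx_measurable mx_set0 mx_setC mx_bigcup.

End measurable_matrix.

Section random.
Context {d} {Om : measurableType d} {R : realType} (P : probability Om R).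

(* The index type is finite and [setT] is an admissible [B i], so the full
   product rule contains the product rule of every subfamily. *)
Definition mutually_independent (I : finType) d' (T : measurableType d')
    (X : I -> Om -> T) : Prop :=
  forall B : I -> set T, (forall i, measurable (B i)) ->
    P (\bigcap_(i in [set: I]) (X i @^-1` B i)) =
    (\prod_(i : I) P (X i @^-1` B i))%E.

Definition identically_distributed (I : Type) d' (T : measurableType d')
    (X : I -> Om -> T) : Prop :=
  forall (i j : I) (B : set T), measurable B ->
    pushforward P (X i) B = pushforward P (X j) B.

Definition iid (I : finType) d' (T : measurableType d')
    (X : I -> Om -> T) : Prop :=
  mutually_independent X /\ identically_distributed X.

Definition independent2 d1 d2 (T1 : measurableType d1) (T2 : measurableType d2)
    (X : Om -> T1) (Y : Om -> T2) : Prop :=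
  forall (A : set T1) (B : set T2), measurable A -> measurable B ->
    P (X @^-1` A `&` Y @^-1` B) = (P (X @^-1` A) * P (Y @^-1` B))%E.

Definition subGaussian (s : R) (Z : Om -> R) : Prop :=
  ('E_P[Z] = 0)%E /\
  forall t : R, (('M_ P Z) t <= (expR (s ^+ 2 * t ^+ 2 / 2))%:E)%E.

Definition subGaussian_vector n (s : R) (Z : Om -> 'rV[R]_n) : Prop :=
  (forall j, ('E_P[fun w => Z w 0%R j] = 0)%E) /\
  forall u : 'cV[R]_n, sq_l2norm u = 1 ->
    subGaussian s (fun w => (Z w *m u) 0 0).

Definition has_covariance n (Z : Om -> 'rV[R]_n) (Sigma : 'M[R]_n) : Prop :=
  forall j l,
    covariance P (fun w => Z w 0 j) (fun w => Z w 0 l) = (Sigma j l)%:E.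

Definition rowwise_subGaussian N n (s : R) (Sigma : 'M[R]_n)
    (X : Om -> 'M[R]_(N, n)) : Prop :=
  [/\ iid (fun i w => row i (X w)),
      forall i, subGaussian_vector s (fun w => row i (X w)) &
      forall i, has_covariance (fun w => row i (X w)) Sigma].

Definition iid_subGaussian_noise N (s : R) (eps : Om -> 'cV[R]_N) : Prop :=
  iid (fun i w => eps w i 0) /\
  forall i, subGaussian s (fun w => eps w i 0).

End random.

Section bounded_in_probability.
Context {R : realType} {d : nat -> measure_display}.
Context {Om : forall t, measurableType (d t)}.
Variable P : forall t, probability (Om t) R.

Definition stochastically_bounded (Z : forall t, Om t -> R) : Prop :=
  forall delta : R, 0 < delta -> exists2 M : R, 0 < M &
    \forall t \near \oo, (P t [set w | (M < `|Z t w|)%R] <= delta%:E)%E.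

Definition le_OP (Z : forall t, Om t -> R) (a : nat -> R) : Prop :=
  stochastically_bounded (fun t w => Z t w / a t).

End bounded_in_probability.

Definition log_ratio {R : realType} (N n : nat) : R := ln (n%:R : R) / N%:R.

(* Main.v *)
Require Import Defs.
From HB Require Import structures.
From mathcomp Require Import all_boot all_order all_algebra.
From mathcomp Require Import all_classical all_reals all_analysis.
From mathcomp Require Import measurable_realfun ring lra.

(** Write v for the estimation error, l for log n / N, and
    a = R1 l^(1 - q1/2) + R2 l^(1 - q2/2); lambda is a constant times sqrt l.

    On a fixed sample. Comparing the objective at the estimator and at the true
    coefficients bounds |X v|^2 / (2 N) by the noise term <X v, eps> / N plus the
    decrease of the two penalties. When every |<X e_j, eps>| is at most
    N lambda / 2, the noise term is at most (lambda / 2) |v|_1. A vector whose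
    q-th powers sum to at most R has at most R tau^(-q) entries above a threshold
    tau, and its other entries sum to at most R tau^(1 - q); this is applied to
    the coefficients and to their graph differences. The difference operator has
    norm at most (2 d)^((k+1)/2), and the graph penalty is calibrated to
    this norm, so that both penalties are controlled by |v|_2. The outcome,
    [lasso_cone], combined with a restricted eigenvalue inequality

      k1 |u|_2^2 - k2 l |u|_1^2 <= |X u|_2^2 / N   for all u,

    gives the three rates in [lasso_rates]. Since a is only bounded, and not
    small, the threshold is K sqrt l with K large in terms of the bound on
    a: a larger K leaves fewer entries above the threshold and shrinks the
    multiple of |v|_2^2 hidden in k2 l |v|_1^2 below k1 |v|_2^2 / 4, while the
    bias grows by a constant factor only.

    The noise. Given eps, <X e_j, eps> is sub-Gaussian with variance proxy
    sigma_x^2 |eps|_2^2, and |eps|_2^2 is at most a constant times N outside an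
    event of probability exp (- 2 N). With the constant in lambda adjusted to
    this, a union over the n columns leaves a probability 2 / n
    ([noise_event]). Because of the conditioning, no relation between log n and N
    enters.

    The design. For one vector u, the lower tail of |X u|_2^2 / N is
    exponentially small in N, since only fourth moments of the design matter for
    a sum of nonnegative variables ([sum_sq_lower_tail]). A union is taken over
    the (2 n)^s sums of s signed basis vectors, with s of order N / log n, and
    Maurey's sampling argument carries the bound to every u at a cost of order
    |u|_1^2 / s, that is l |u|_1^2 ([greedy_sparse_approximation],
    [restricted_eigenvalue_event]). When l is bounded below this choice of s
    breaks down, but then the inequality is trivial because |u|_2 <= |u|_1. *)

Set Implicit Arguments.
Unset Strict Implicit.
Unset Printing Implicit Defensive.

Import Order.TTheory GRing.Theory Num.Theory.
Import numFieldNormedType.Exports.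
Import HBNNSimple.
Local Open Scope classical_set_scope.
Local Open Scope ring_scope.

(** * Expectations of products of independent variables *)

Section independence.
Context d (Om : measurableType d) (R : realType) (P : probability Om R).

(** Only an inequality is claimed: an upper bound for simple functions passes to
    the monotone limit whether or not the integral of [f] is finite. *)
Lemma le_integral_indep d' (T : measurableType d') (X : Om -> T)
    (W : Om -> R) (w : R) (f : T -> R) :
  measurable_fun setT X -> measurable_fun setT W ->
  (forall x, 0 <= W x) -> 0 <= w ->
  (forall B, measurable B ->
     (\int[P]_x (\1_B (X x) * W x)%:E <= P (X @^-1` B) * w%:E)%E) ->
  measurable_fun setT f -> (forall x, 0 <= f x) ->
  (\int[P]_x (f (X x) * W x)%:E <= (\int[P]_x (f (X x))%:E) * w%:E)%E.
Proof.
move=> mX mW W0 w0 H mf f0.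
have mEf : measurable_fun [set: T] (EFin \o f) by exact/measurable_EFinP.
pose g := nnsfun_approx measurableT mEf.
have gX n : measurable_fun setT (fun x => g n (X x)) by exact: measurableT_comp.
have step n : (\int[P]_x (g n (X x) * W x)%:E <=
    (\int[P]_x (g n (X x))%:E) * w%:E)%E.
  (* The range of [g n] is finite and nonnegative; below its values y are written
     as maxima with 0 so that every term of the sums is visibly nonnegative. *)
  pose rg := finmap.enum_fset (fset_set (range (g n))).
  have gE t : g n t = \sum_(y <- rg) y * \1_(g n @^-1` [set y]) t.
    by rewrite {1}(fimfunE (g n) t) fsbig_finite//.
  have rg0 (y : R) : y \in rg -> 0 <= y.
    by rewrite in_fset_set// inE => -[t _ <-].
  have mI y : measurable (g n @^-1` [set y]) by exact: measurable_sfunP.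
  have mIX y : measurable_fun setT (fun x => \1_(g n @^-1` [set y]) (X x) : R).
    by apply: measurableT_comp => //; exact: measurable_indic.
  have -> : (\int[P]_x (g n (X x) * W x)%:E =
     \sum_(y <- rg) \int[P]_x (Num.max 0 y * (\1_(g n @^-1` [set y]) (X x) * W x))%:E)%E.
    rewrite -ge0_integral_sum//.
    - apply: eq_integral => x _; rewrite gE mulr_suml sumEFin; congr EFin.
      rewrite !big_seq; apply: eq_bigr => y yr.
      by rewrite mulrA; congr (_ * _ * _); rewrite max_r// rg0.
    - move=> y; apply/measurable_EFinP; apply: measurable_funM => //.
      exact: measurable_funM.
    - by move=> y x _; rewrite lee_fin !mulr_ge0// le_max lexx.
  have -> : (\int[P]_x (g n (X x))%:E =
     \sum_(y <- rg) \int[P]_x (Num.max 0 y * (\1_(g n @^-1` [set y]) (X x)))%:E)%E.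
    rewrite -ge0_integral_sum//.
    - apply: eq_integral => x _; rewrite gE sumEFin; congr EFin.
      rewrite !big_seq; apply: eq_bigr => y yr.
      by congr (_ * _); rewrite max_r// rg0.
    - move=> y; apply/measurable_EFinP; exact: measurable_funM.
    - by move=> y x _; rewrite lee_fin !mulr_ge0// le_max lexx.
  rewrite ge0_sume_distrl; last first.
    by move=> y _; apply: integral_ge0 => x _; rewrite lee_fin mulr_ge0// le_max lexx.
  apply: lee_sum => y _.
  have m0 : 0 <= Num.max 0 y by rewrite le_max lexx.
  under eq_integral do rewrite EFinM.
  rewrite ge0_integralZl_EFin//; last 2 first.
    by move=> x _; rewrite lee_fin mulr_ge0.
    by apply/measurable_EFinP; exact: measurable_funM.
  under [in leRHS]eq_integral do rewrite EFinM.
  rewrite ge0_integralZl_EFin//; last first.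
    exact/measurable_EFinP.
  rewrite -muleA; apply: lee_wpmul2l => //.
  apply: (le_trans (H _ (mI y))); apply: lee_wpmul2r => //.
  rewrite -[X in (P X <= _)%E]setIT -integral_indic//; last first.
    by rewrite -[X in measurable X]setTI; exact: mX.
have lim : (\int[P]_x (f (X x) * W x)%:E = limn (fun n => \int[P]_x (g n (X x) * W x)%:E))%E.
  rewrite -monotone_convergence//.
  - apply: eq_integral => x _; apply/esym/cvg_lim => //.
    apply: cvg_EFin; first by near=> n.
    have : EFin \o (g ^~ (X x)) @ \oo --> (EFin \o f) (X x).
      by apply: cvg_nnsfun_approx => // t _; rewrite lee_fin.
    move=> /fine_cvgP [_ h].
    by apply: (cvgM h (cvg_cst (W x))).
  - move=> n; apply/measurable_EFinP; exact: measurable_funM.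
  - by move=> n x _; rewrite lee_fin mulr_ge0.
  - move=> x _ m n mn; rewrite lee_fin ler_wpM2r//.
    by have /lefP/(_ (X x)) := nd_nnsfun_approx measurableT mEf mn.
rewrite lim; apply: lime_le.
  apply: ereal_nondecreasing_is_cvgn => m n mn.
  apply: ge0_le_integral => //.
  - by move=> x _; rewrite lee_fin mulr_ge0.
  - apply/measurable_EFinP; exact: measurable_funM.
  - apply/measurable_EFinP; exact: measurable_funM.
  - move=> x _; rewrite lee_fin ler_wpM2r//.
    by have /lefP/(_ (X x)) := nd_nnsfun_approx measurableT mEf mn.
near=> n; apply: (le_trans (step n)); apply: lee_wpmul2r => //.
apply: ge0_le_integral => //.
- by move=> x _; rewrite lee_fin.
- exact/measurable_EFinP.
- by apply/measurable_EFinP; exact: measurableT_comp.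
- move=> x _; rewrite /g nnsfun_approxE; apply: le_approx => // t _; rewrite /= lee_fin.
Unshelve. all: by end_near.
Qed.

(** The factors are introduced one at a time. In the intermediate claim the
    indices of a list carry [f i] and the others carry indicators; for the empty
    list this is the product rule that defines independence. *)
Lemma le_integral_prod_indep (I : finType) d' (T : measurableType d')
    (X : I -> Om -> T) (f : I -> T -> R) (c : I -> R) :
  mutually_independent P X -> (forall i, measurable_fun setT (X i)) ->
  (forall i, measurable_fun setT (f i)) -> (forall i x, 0 <= f i x) ->
  (forall i, \int[P]_x (f i (X i x))%:E <= (c i)%:E)%E ->
  (\int[P]_x (\prod_i f i (X i x))%:E <= (\prod_i c i)%:E)%E.
Proof.
move=> iX mX mf f0 fc.
have c0 i : 0 <= c i.
  rewrite -lee_fin; apply: le_trans (fc i).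
  by apply: integral_ge0 => x _; rewrite lee_fin.
suff claim (s : seq I) (B : I -> set T) : (forall i, measurable (B i)) ->
  (\int[P]_x (\prod_i (if i \in s then f i (X i x) else \1_(B i) (X i x)))%:E <=
   (\prod_i (if i \in s then c i else fine (P (X i @^-1` B i))))%:E)%E.
  have := claim (enum I) (fun=> setT) (fun=> measurableT).
  under eq_integral do under eq_bigr do rewrite mem_enum /=.
  by under [X in (_ <= X%:E)%E]eq_bigr do rewrite mem_enum /=.
have mXB i (D : set T) : measurable D -> measurable (X i @^-1` D).
  by move=> mD; rewrite -[X in measurable X]setTI; exact: mX.
elim: s B => [|m s IH] B mB.
  have -> : (fun x => (\prod_i (if i \in [::] then f i (X i x) else \1_(B i) (X i x)))%:E)
     = (fun x => (\1_(\bigcap_(i in [set: I]) (X i @^-1` B i)) x)%:E).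
    apply/funext => x; congr EFin.
    transitivity (\prod_i (\1_(B i) (X i x)) : R); first by apply: eq_bigr.
    rewrite [RHS]indicE; have [h|h] := pselect ((\bigcap_(i in [set: I]) (X i @^-1` B i)) x).
    + have -> : (x \in \bigcap_(i in setT) X i @^-1` B i) by rewrite inE.
      by rewrite big1// => i _; rewrite indicE mem_set//; exact: h.
    + have [i hi] : exists i, ~ B i (X i x).
        apply: contrapT => h'; apply: h => i _ /=.
        by apply: contrapT => hi; apply: h'; exists i.
      rewrite memNset//.
      by rewrite (bigD1 i)//= indicE memNset// mul0r.
  rewrite integral_indic//; last first.
    by apply: fin_bigcap_measurable => // i _; exact: mXB.
  rewrite setIT [X in (X <= _)%E](iX B mB).
  have -> : \prod_i (if i \in [::] then c i else fine (P (X i @^-1` B i))) =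
     \prod_i fine (P (X i @^-1` B i)) by apply: eq_bigr.
  rewrite -prodEFin le_eqVlt; apply/orP; left; apply/eqP.
  by apply: eq_bigr => i _; rewrite fineK// fin_num_measure//; exact: mXB.
have [ms|ms] := boolP (m \in s).
  have E i : (i \in m :: s) = (i \in s).
    by rewrite in_cons; case: eqP => // ->; rewrite ms.
  under eq_integral do under eq_bigr do rewrite E.
  under [X in (_ <= X%:E)%E]eq_bigr do rewrite E.
  exact: IH.
have E i : i != m -> (i \in m :: s) = (i \in s).
  by move=> im; rewrite in_cons (negbTE im).
pose W x := \prod_(i | i != m) (if i \in s then f i (X i x) else \1_(B i) (X i x)).
pose w := \prod_(i | i != m) (if i \in s then c i else fine (P (X i @^-1` B i))).
have w0 : 0 <= w.
  by apply: prodr_ge0 => i _; case: ifP => // _; exact: fine_ge0.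
have -> : \prod_i (if i \in m :: s then c i else fine (P (X i @^-1` B i))) = c m * w.
  rewrite (bigD1 m)//= mem_head; congr (_ * _).
  by apply: eq_bigr => i im; rewrite E.
have -> : (fun x => (\prod_i (if i \in m :: s then f i (X i x) else \1_(B i) (X i x)))%:E) =
   (fun x => (f m (X m x) * W x)%:E).
  apply/funext => x; congr EFin.
  rewrite (bigD1 m)//= mem_head; congr (_ * _).
  by apply: eq_bigr => i im; rewrite E.
rewrite EFinM; apply: (@le_trans _ _ ((\int[P]_x (f m (X m x))%:E) * w%:E)%E); last first.
  by apply: lee_wpmul2r; rewrite ?lee_fin.
apply: le_integral_indep => //.
- rewrite /W; under eq_fun do rewrite big_mkcond.
  apply: (@measurable_prod _ _ _ _ _ _ (fun i x => if i != m then
    if i \in s then f i (X i x) else \1_(B i) (X i x) else 1)) => i _.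
  case: (i != m); last exact: measurable_cst.
  case: (i \in s).
    exact: measurableT_comp.
  by apply: measurableT_comp => //; exact: measurable_indic.
- by move=> x; apply: prodr_ge0 => i _; case: ifP.
- move=> D mD; pose B' i := if i == m then D else B i.
  have mB' i : measurable (B' i) by rewrite /B'; case: ifP.
  have := IH B' mB'.
  have -> : (fun x => (\prod_i (if i \in s then f i (X i x) else \1_(B' i) (X i x)))%:E)
     = (fun x => (\1_D (X m x) * W x)%:E).
    apply/funext => x; congr EFin.
    rewrite (bigD1 m)//= (negbTE ms) /B' eqxx; congr (_ * _).
    by apply: eq_bigr => i im; rewrite (negbTE im).
  rewrite (bigD1 m)//= (negbTE ms) {1}/B' eqxx EFinM fineK ?fin_num_measure//; last exact: mXB.
  suff -> : \prod_(i | i != m) (if i \in s then c i else fine (P (X i @^-1` B' i))) = w by [].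
  by apply: eq_bigr => i im; rewrite /B' (negbTE im).
Qed.

End independence.

(** * Moments of sub-Gaussian variables *)

Section sub_gaussian_moments.
Context d (Om : measurableType d) (R : realType) (P : probability Om R).

Definition mgf_bounded (s : R) (Z : Om -> R) :=
  forall t, (\int[P]_x (expR (t * Z x))%:E <= (expR (s ^+ 2 * t ^+ 2 / 2))%:E)%E.

Lemma subGaussian_mgf (s : R) (Z : Om -> R) : subGaussian P s Z -> mgf_bounded s Z.
Proof.
move=> [_ H] t; have := H t; rewrite /mmt_gen_fun unlock /=.
by under eq_integral do rewrite mulrC.
Qed.

Lemma measurable_expR_scale (t : R) (Z : Om -> R) : measurable_fun setT Z ->
  measurable_fun setT (fun x => (expR (t * Z x))%:E).
Proof.
move=> mZ; apply/measurable_EFinP; apply: measurableT_comp => //.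
exact: measurable_funM.
Qed.

Lemma mgf_bounded_cosh (s : R) (Z : Om -> R) (t : R) : measurable_fun setT Z ->
  mgf_bounded s Z ->
  (\int[P]_x (expR (t * Z x) + expR (- (t * Z x)))%:E <=
   (2 * expR (s ^+ 2 * t ^+ 2 / 2))%:E)%E.
Proof.
move=> mZ H.
under eq_integral do rewrite EFinD.
rewrite ge0_integralD//; last 2 first.
- exact: measurable_expR_scale.
- under eq_fun do rewrite -mulNr; exact: measurable_expR_scale.
rewrite mulr_natl mulr2n EFinD; apply: leeD; first exact: H.
under eq_integral do rewrite -mulNr.
by apply: (le_trans (H (- t))); rewrite sqrrN.
Qed.

(** All moments below come from dominating the integrand by a multiple of
    cosh (t Z). *)
Lemma mgf_bounded_le (s : R) (Z f : Om -> R) (t c : R) : measurable_fun setT Z ->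
  mgf_bounded s Z -> measurable_fun setT f -> 0 <= c -> (forall x, 0 <= f x) ->
  (forall x, f x <= c * (expR (t * Z x) + expR (- (t * Z x)))) ->
  (\int[P]_x (f x)%:E <= (c * (2 * expR (s ^+ 2 * t ^+ 2 / 2)))%:E)%E.
Proof.
move=> mZ H mf c0 f0 fle.
have mc : measurable_fun setT (fun x => (expR (t * Z x) + expR (- (t * Z x)))%:E).
  apply/measurable_EFinP; apply: measurable_funD; first exact/measurable_EFinP/measurable_expR_scale.
  under eq_fun do rewrite -mulNr; exact/measurable_EFinP/measurable_expR_scale.
apply: (@le_trans _ _ (\int[P]_x (c%:E * (expR (t * Z x) + expR (- (t * Z x)))%:E))%E).
  apply: ge0_le_integral => //.
  - by move=> x _; rewrite lee_fin.
  - exact/measurable_EFinP.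
  - exact: measurable_funeM.
  - by move=> x _; rewrite -EFinM lee_fin.
rewrite ge0_integralZl_EFin//.
by rewrite EFinM lee_wpmul2l// mgf_bounded_cosh.
Qed.

(** Expanding the exponential, y^4 / 4! <= exp |y| with y = Z / s. *)
Lemma fourth_moment_le (s : R) (Z : Om -> R) : 0 < s -> measurable_fun setT Z ->
  mgf_bounded s Z ->
  (\int[P]_x (Z x ^+ 4)%:E <= (48 * expR (1 / 2) * s ^+ 4)%:E)%E.
Proof.
move=> s0 mZ H.
have sn0 : s != 0 by rewrite gt_eqF.
apply: (le_trans (mgf_bounded_le (t := s^-1) (c := 24 * s ^+ 4) mZ H _ _ _ _)).
- exact: measurable_funX.
- by rewrite mulr_ge0// exprn_ge0// ltW.
- by move=> x; rewrite -[4%N]/(2 * 2)%N exprM sqr_ge0.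
- move=> x; set y := s^-1 * Z x.
  have -> : Z x = s * y by rewrite /y mulrA divff// mul1r.
  rewrite exprMn (_ : 24 * s ^+ 4 * _ = s ^+ 4 * (24 * (expR y + expR (- y)))); last by ring.
  apply: ler_wpM2l; rewrite ?exprn_ge0 ?(ltW s0)//.
  have -> : y ^+ 4 = `|y| ^+ 4.
    by rewrite -[4%N]/(2 * 2)%N !exprM real_normK// num_real.
  have /= h := @expR_ge1Dxn _ `|y| 3 (normr_ge0 _).
  have h2 : expR `|y| <= expR y + expR (- y).
    by have [y0|y0] := ger0P y; rewrite ?lerDl ?lerDr expR_ge0.
  rewrite !factS fact0 in h.
  have : `|y| ^+ 4 / 24 <= expR `|y| by move: h; rewrite /=; lra.
  rewrite ler_pdivrMr//; nra.
- rewrite lee_fin; have -> : s ^+ 2 * s^-1 ^+ 2 = 1.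
    by rewrite -exprMn divff// expr1n.
  by rewrite le_eqVlt; apply/orP; left; apply/eqP; ring.
Qed.

(** Any rate below 1 / (2 s^2) makes the exponential moment of the square finite.
    This one equals 1 / (4 b) with b = s^2 / 2 + 1, so that the dominating series
    of [sq_exp_moment_le] decays like exp (- k^2). *)
Definition sq_exp_rate (s : R) : R := (4 * (s ^+ 2 / 2 + 1))^-1.
Definition sq_exp_bound (s : R) : R := 4 * expR ((s ^+ 2 / 2 + 1) / 4).

(** A discrete form of the identity writing exp (z^2) as a Gaussian mixture of
    exponentials: k |z| - b k^2 has maximum z^2 / (4 b), at k = |z| / (2 b), and
    rounding to the nearest integer loses at most b / 4. *)
Lemma expR_sq_le_dominant (b z : R) : 0 < b -> exists k : nat,
  expR (z ^+ 2 / (4 * b)) <=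
  expR (b / 4) * expR (- (b * k%:R ^+ 2)) * (expR (k%:R * z) + expR (- (k%:R * z))).
Proof.
move=> b0; pose x := `|z| / (2 * b).
have x0 : 0 <= x by rewrite /x divr_ge0// mulr_ge0// ltW.
pose k := Num.truncn (x + 1 / 2).
have x2 : 0 <= x + 1 / 2 by rewrite addr_ge0.
have /andP[k1 k2] := truncn_itv x2; rewrite -/k in k1 k2.
have k3 : x + 1 / 2 < k%:R + 1 by rewrite natr1.
exists k.
apply: (@le_trans _ _ (expR (b / 4) * expR (- (b * k%:R ^+ 2)) * expR (k%:R * `|z|))).
  rewrite -!expRD ler_expR.
  have -> : `|z| = 2 * b * x by rewrite /x mulrC divfK// gt_eqF// mulr_gt0.
  have -> : z ^+ 2 / (4 * b) = b * x ^+ 2.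
    have -> : z ^+ 2 = `|z| ^+ 2 by rewrite real_normK// num_real.
    rewrite /x; field; by rewrite gt_eqF.
  have : (x - k%:R) ^+ 2 <= 1 / 4.
    move: (k1) (k3); nra.
  rewrite -subr_ge0 => h; rewrite -subr_ge0.
  have -> : b / 4 - b * k%:R ^+ 2 + k%:R * (2 * b * x) - b * x ^+ 2 = b * (1 / 4 - (x - k%:R) ^+ 2).
    by field.
  by rewrite mulr_ge0// ltW.
apply: ler_wpM2l; first by rewrite mulr_ge0// expR_ge0.
have [y0|y0] := ger0P z; first by rewrite lerDl expR_ge0.
by rewrite mulrN lerDr expR_ge0.
Qed.

Lemma expR1_ge2 : 2 <= expR 1 :> R.
Proof. by have := @expR_ge1Dx R 1; lra. Qed.

(** Summing the dominating terms over all k and integrating, the k-th term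
    contributes at most 2 exp (b / 4) exp (- k^2). *)
Lemma sq_exp_moment_le (s : R) (Z : Om -> R) : measurable_fun setT Z ->
  mgf_bounded s Z ->
  (\int[P]_x (expR (sq_exp_rate s * Z x ^+ 2))%:E <= (sq_exp_bound s)%:E)%E.
Proof.
move=> mZ H; pose b := s ^+ 2 / 2 + 1.
have b0 : 0 < b by rewrite ltr_wpDl// divr_ge0// sqr_ge0.
pose F (k : nat) (x : Om) : R := expR (b / 4) * expR (- (b * k%:R ^+ 2)) *
  (expR (k%:R * Z x) + expR (- (k%:R * Z x))).
have F0 k x : 0 <= F k x by rewrite !mulr_ge0 ?addr_ge0 ?expR_ge0.
have mF k : measurable_fun setT (F k).
  apply: measurable_funM => //; apply: measurable_funD.
    exact/measurable_EFinP/measurable_expR_scale.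
  under eq_fun do rewrite -mulNr; exact/measurable_EFinP/measurable_expR_scale.
apply: (@le_trans _ _ (\int[P]_x (\sum_(k <oo) (F k x)%:E))%E).
  apply: ge0_le_integral => //.
  - apply/measurable_EFinP; apply: measurableT_comp => //.
    by apply: measurable_funM => //; exact: measurable_funX.
  - apply: ge0_emeasurable_sum => [k x _ _|k _]; first by rewrite lee_fin.
    exact/measurable_EFinP.
  - move=> x _; have [k hk] := expR_sq_le_dominant (Z x) b0.
    apply: (@le_trans _ _ (\sum_(0 <= i < k.+1) (F i x)%:E)%E); last first.
      by apply: nneseries_lim_ge => n _ _; rewrite lee_fin.
    rewrite big_nat_recr//= -[leLHS]add0e; apply: leeD.
      by apply: sume_ge0 => i _; rewrite lee_fin.
    by rewrite lee_fin /sq_exp_rate -/b mulrC.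
rewrite integral_nneseries//; last 2 first.
- by move=> k; exact/measurable_EFinP.
- by move=> k x _; rewrite lee_fin.
apply: lime_le.
  apply: is_cvg_nneseries => k _ _; apply: integral_ge0 => x _; by rewrite lee_fin.
apply: nearW => n.
have Fk k : (\int[P]_x (F k x)%:E <= (2 * expR (b / 4) * 2^-1 ^+ k)%:E)%E.
  apply: (le_trans (mgf_bounded_le (t := k%:R)
    (c := expR (b / 4) * expR (- (b * k%:R ^+ 2))) mZ H _ _ _ _)) => //.
  - rewrite lee_fin (_ : _ * (2 * _) = 2 * expR (b / 4) * (expR (- (b * k%:R ^+ 2)) *
      expR (s ^+ 2 * k%:R ^+ 2 / 2))); last by ring.
    rewrite ler_pM2l ?mulr_gt0 ?expR_gt0// -expRD /b.
    apply: (@le_trans _ _ (expR (- 1) ^+ k)).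
      rewrite -expRM_natl ler_expR.
      have : k%:R <= k%:R ^+ 2 :> R by rewrite -natrX ler_nat; case: (k) => // m; rewrite expnS leq_pmulr// expn_gt0.
      lra.
    rewrite lerXn2r ?nnegrE ?expR_ge0 ?invr_ge0//.
    by rewrite expRN lef_pV2 ?posrE ?expR_gt0// expR1_ge2.
apply: (@le_trans _ _ (\sum_(0 <= k < n) (2 * expR (b / 4) * 2^-1 ^+ k)%:E)%E).
  exact: lee_sum.
rewrite sumEFin lee_fin -mulr_sumr.
have : \sum_(0 <= k < n) (2^-1 : R) ^+ k <= 2.
  have -> : \sum_(0 <= k < n) (2^-1 : R) ^+ k = 2 - 2 * 2^-1 ^+ n.
    elim: n => [|n IH]; first by rewrite big_nil expr0; lra.
    by rewrite big_nat_recr//= IH exprS; lra.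
  have : 0 <= (2^-1 : R) ^+ n by rewrite exprn_ge0// invr_ge0.
  lra.
have := expR_gt0 (b / 4); rewrite /sq_exp_bound -/b; nra.
Qed.

End sub_gaussian_moments.

(** * Tails of sums of independent squares *)

Section tail_bounds.
Context d (Om : measurableType d) (R : realType) (P : probability Om R).

Lemma measurable_gt_set (f : Om -> R) (a : R) : measurable_fun setT f ->
  measurable [set x | a < f x].
Proof.
move=> mf; have := measurable_fun_ltr (measurable_cst a) mf => /(_ measurableT [set true]).
by rewrite setTI => h; rewrite (_ : [set x | _] = (fun x => a < f x) @^-1` [set true])//; apply: h.
Qed.

Lemma measurable_lt_set (f : Om -> R) (a : R) : measurable_fun setT f ->
  measurable [set x | f x < a].
Proof.
move=> mf; have := measurable_fun_ltr mf (measurable_cst a) => /(_ measurableT [set true]).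
by rewrite setTI => h; rewrite (_ : [set x | _] = (fun x => f x < a) @^-1` [set true])//; apply: h.
Qed.

Lemma markov_set (A : set Om) (g : Om -> R) (a c : R) : 0 < a ->
  measurable A -> measurable_fun setT g -> (forall x, 0 <= g x) ->
  (forall x, A x -> a <= g x) ->
  (\int[P]_x (g x)%:E <= c%:E)%E ->
  (P A <= (c / a)%:E)%E.
Proof.
move=> a0 mA mg g0 Ag H.
rewrite EFinM lee_pdivlMr// muleC.
apply: le_trans H.
rewrite -[A in P A]setIT -integral_indic// -ge0_integralZl_EFin ?(ltW a0)//; last first.
  exact/measurable_EFinP/measurable_indic.
apply: ge0_le_integral => //.
- by move=> x _; rewrite -EFinM lee_fin mulr_ge0// ltW.
- by apply: measurable_funeM; exact/measurable_EFinP/measurable_indic.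
- exact/measurable_EFinP.
- move=> x _; rewrite -EFinM lee_fin indicE.
  have [xA|xA] := boolP (x \in A); last by rewrite mulr0.
  by rewrite mulr1; apply: Ag; rewrite inE in xA.
Qed.

Lemma markov_expR (A : set Om) (S : Om -> R) (a c : R) :
  measurable A -> measurable_fun setT S ->
  (forall x, A x -> a <= S x) ->
  (\int[P]_x (expR (S x))%:E <= c%:E)%E ->
  (P A <= (c * expR (- a))%:E)%E.
Proof.
move=> mA mS AS H; rewrite expRN.
apply: (markov_set (expR_gt0 a) mA _ _ _ H) => [|x|x /AS].
- exact: measurableT_comp.
- exact: expR_ge0.
- by rewrite ler_expR.
Qed.

(** The level, per summand, at which the Chernoff bound for a sum of m squares is
    exp (- 2 m). The exponent 2, rather than 1, pays for a later union over as
    many as exp N columns. *)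
Definition sq_tail (s : R) : R := (ln (sq_exp_bound s) + 2) / sq_exp_rate s.

Lemma sq_exp_rate_gt0 (s : R) : 0 < sq_exp_rate s.
Proof. by rewrite invr_gt0 mulr_gt0// ltr_wpDl// divr_ge0// sqr_ge0. Qed.

Lemma sq_exp_bound_gt1 (s : R) : 1 < sq_exp_bound s.
Proof.
have : 1 <= expR ((s ^+ 2 / 2 + 1) / 4).
  by rewrite -expR0 ler_expR divr_ge0// addr_ge0// divr_ge0// sqr_ge0.
rewrite /sq_exp_bound; lra.
Qed.

Lemma sq_tail_gt0 (s : R) : 0 < sq_tail s.
Proof.
by rewrite divr_gt0 ?sq_exp_rate_gt0// ltr_wpDl// ln_ge0// ltW// sq_exp_bound_gt1.
Qed.

Context (I : finType) d' (T : measurableType d').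
Variables (X : I -> Om -> T) (h : I -> T -> R).
Hypothesis iX : mutually_independent P X.
Hypothesis mX : forall i, measurable_fun setT (X i).
Hypothesis mh : forall i, measurable_fun setT (h i).

Let mhX i : measurable_fun setT (fun x => h i (X i x)).
Proof. exact: measurableT_comp. Qed.

Let msum : measurable_fun setT (fun x => \sum_i h i (X i x) ^+ 2).
Proof. by apply: measurable_sum => i; exact: measurable_funX. Qed.

Lemma sum_sq_upper_tail (s : R) :
  (forall i, mgf_bounded P s (fun x => h i (X i x))) ->
  (P [set x | (sq_tail s * #|I|%:R < \sum_i h i (X i x) ^+ 2)%R] <=
     (expR (- (2 * #|I|%:R)))%:E)%E.
Proof.
move=> H; pose th := sq_exp_rate s; pose D := sq_exp_bound s.
have th0 : 0 < th by exact: sq_exp_rate_gt0.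
have D0 : 0 < D by apply: lt_trans (sq_exp_bound_gt1 s).
have := @markov_expR [set x | sq_tail s * #|I|%:R < \sum_i h i (X i x) ^+ 2]
  (fun x => \sum_i th * h i (X i x) ^+ 2) (th * (sq_tail s * #|I|%:R)) (D ^+ #|I|).
have -> : D ^+ #|I| * expR (- (th * (sq_tail s * #|I|%:R))) = expR (- (2 * #|I|%:R)).
  have -> : th * (sq_tail s * #|I|%:R) = ln D * #|I|%:R + 2 * #|I|%:R.
    by rewrite /sq_tail -/th -/D; field; rewrite gt_eqF.
  rewrite opprD expRD expRN expRM_natr lnK ?posrE// mulrA divff ?mul1r//.
  by rewrite expf_neq0// gt_eqF.
apply.
- exact: measurable_gt_set.
- by apply: measurable_sum => i; apply: measurable_funM => //; exact: measurable_funX.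
- by move=> x /= /ltW hx; rewrite -mulr_sumr ler_pM2l.
- under eq_integral do rewrite expR_sum.
  have := @le_integral_prod_indep _ _ _ P _ _ _ X (fun i y => expR (th * h i y ^+ 2)) (fun=> D) iX mX.
  rewrite prodr_const; apply.
  + move=> i; apply: measurableT_comp => //; apply: measurable_funM => //.
    exact: measurable_funX.
  + by move=> i x; exact: expR_ge0.
  + by move=> i; exact: sq_exp_moment_le.
Qed.

Lemma expR_opp_le (y : R) : 0 <= y -> expR (- y) <= 1 - y + y ^+ 2.
Proof.
move=> y0; rewrite expRN -[leLHS]mul1r ler_pdivrMr ?expR_gt0//.
have h1 := expR_ge1Dx y.
have h2 : 0 <= 1 - y + y ^+ 2 by nra.
apply: le_trans (ler_wpM2l h2 h1).
have -> : (1 - y + y ^+ 2) * (1 + y) = 1 + y ^+ 3 by ring.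
by rewrite lerDl exprn_ge0.
Qed.

(** For nonnegative variables the lower tail needs no exponential moment: with
    exp (- y) <= 1 - y + y^2, first and second moments of the squares bound their
    moment generating function at - t. The exponent is optimal at
    t = v / (4 K). *)
Lemma sum_sq_lower_tail (v K : R) : 0 < v -> 0 < K ->
  (forall i, (v%:E <= \int[P]_x (h i (X i x) ^+ 2)%:E)%E) ->
  (forall i, (\int[P]_x (h i (X i x) ^+ 4)%:E <= K%:E)%E) ->
  (P [set x | (\sum_i h i (X i x) ^+ 2 < v / 2 * #|I|%:R)%R] <=
     (expR (- (v ^+ 2 / (16 * K) * #|I|%:R)))%:E)%E.
Proof.
move=> v0 K0 Hv HK; pose t := v / (4 * K).
have t0 : 0 < t by rewrite divr_gt0// mulr_gt0.
have mgf i : (\int[P]_x (expR (- (t * h i (X i x) ^+ 2)))%:E <= (expR (- (t * v) + t ^+ 2 * K))%:E)%E.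
  have m2 : measurable_fun setT (fun x => h i (X i x) ^+ 2) by exact: measurable_funX.
  have m4 : measurable_fun setT (fun x => h i (X i x) ^+ 4) by exact: measurable_funX.
  have m1 : measurable_fun setT (fun x => expR (- (t * h i (X i x) ^+ 2))).
    apply: measurableT_comp => //; under eq_fun do rewrite -mulNr.
    exact: measurable_funM.
  have le1 : (\int[P]_x (expR (- (t * h i (X i x) ^+ 2)))%:E + (t * v)%:E <= (1 + t ^+ 2 * K)%:E)%E.
    apply: (@le_trans _ _ (\int[P]_x ((expR (- (t * h i (X i x) ^+ 2)))%:E + (t * h i (X i x) ^+ 2)%:E))%E).
      rewrite ge0_integralD//; last 3 first.
      - exact/measurable_EFinP.
      - by move=> x _; rewrite lee_fin mulr_ge0 ?sqr_ge0// ltW.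
      - by apply/measurable_EFinP; exact: measurable_funM.
      apply: leeD => //; under eq_integral do rewrite EFinM.
      rewrite ge0_integralZl_EFin ?(ltW t0)//; last 2 first.
      - by move=> x _; rewrite lee_fin sqr_ge0.
      - exact/measurable_EFinP.
      by rewrite EFinM lee_wpmul2l// lee_fin ltW.
    apply: (@le_trans _ _ (\int[P]_x (1%:E + (t ^+ 2 * h i (X i x) ^+ 4)%:E))%E).
      apply: ge0_le_integral => //.
      - by move=> x _; rewrite -EFinD lee_fin addr_ge0 ?expR_ge0// mulr_ge0 ?sqr_ge0// ltW.
      - apply: emeasurable_funD; first exact/measurable_EFinP.
        by apply/measurable_EFinP; exact: measurable_funM.
      - apply: emeasurable_funD; first exact: measurable_cst.
        by apply/measurable_EFinP; exact: measurable_funM.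
      - move=> x _; rewrite -!EFinD lee_fin.
        have y0 : 0 <= t * h i (X i x) ^+ 2 by rewrite mulr_ge0 ?sqr_ge0// ltW.
        have := expR_opp_le y0; rewrite exprMn -exprM; lra.
    rewrite ge0_integralD//; last 2 first.
    - by move=> x _; rewrite lee_fin -[4%N]/(2*2)%N exprM mulr_ge0 ?sqr_ge0.
    - by apply/measurable_EFinP; exact: measurable_funM.
    rewrite [X in (X + _)%E](_ : _ = 1%:E); last first.
      by rewrite (integral_cst P measurableT 1%:E) mul1e; exact: probability_setT.
    rewrite EFinD; apply: leeD => //.
    under eq_integral do rewrite EFinM.
    rewrite ge0_integralZl_EFin ?sqr_ge0//; last 2 first.
    - by move=> x _; rewrite lee_fin -[4%N]/(2*2)%N exprM sqr_ge0.
    - exact/measurable_EFinP.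
    rewrite [in leRHS]EFinM; apply: lee_wpmul2l => //; by rewrite lee_fin sqr_ge0.
  apply: (@le_trans _ _ (1 + (- (t * v) + t ^+ 2 * K))%:E); last by rewrite lee_fin expR_ge1Dx.
  rewrite [X in (_ <= X%:E)%E](_ : _ = 1 + t ^+ 2 * K - t * v); last by ring.
  by rewrite EFinB leeBrDr.
have := @markov_expR [set x | (\sum_i h i (X i x) ^+ 2 < v / 2 * #|I|%:R)%R]
  (fun x => \sum_i - (t * h i (X i x) ^+ 2)) (- (t * (v / 2 * #|I|%:R))) (expR (- (t * v) + t ^+ 2 * K) ^+ #|I|).
have -> : expR (- (t * v) + t ^+ 2 * K) ^+ #|I| * expR (- - (t * (v / 2 * #|I|%:R))) = expR (- (v ^+ 2 / (16 * K) * #|I|%:R)).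
  rewrite -expRM_natr -expRD; congr expR; rewrite /t; field.
  by rewrite gt_eqF.
apply.
- exact: measurable_lt_set.
- apply: measurable_sum => i; under eq_fun do rewrite -mulNr.
  by apply: measurable_funM => //; exact: measurable_funX.
- by move=> x /= /ltW hx; rewrite sumrN -mulr_sumr lerN2 ler_pM2l.
- under eq_integral do rewrite expR_sum.
  have := @le_integral_prod_indep _ _ _ P _ _ _ X (fun i y => expR (- (t * h i y ^+ 2))) (fun=> expR (- (t * v) + t ^+ 2 * K)) iX mX.
  rewrite prodr_const; apply => //.
  move=> i; apply: measurableT_comp => //; under eq_fun do rewrite -mulNr.
  by apply: measurable_funM => //; exact: measurable_funX.
Qed.

End tail_bounds.

(** * Quadratic forms and the smallest eigenvalue *)

Definition bform (R : realType) m (M : 'M[R]_m) (u v : 'cV[R]_m) : R :=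
  (u^T *m M *m v) 0 0.

Local Notation qform M u := (bform M u u).

Section quadratic_forms.
Context (R : realType).

Lemma sq_l2norm_ge0 m (u : 'cV[R]_m) : 0 <= sq_l2norm u.
Proof. by apply: sumr_ge0 => i _; exact: sqr_ge0. Qed.

Lemma sq_l2normE m (u : 'cV[R]_m) : sq_l2norm u = (u^T *m u) 0 0.
Proof. by rewrite mxE; apply: eq_bigr => i _; rewrite mxE expr2. Qed.

Lemma sq_l2norm_eq0 m (u : 'cV[R]_m) : sq_l2norm u = 0 -> u = 0.
Proof.
move=> /eqP; rewrite psumr_eq0; last by move=> i _; exact: sqr_ge0.
move=> /allP h; apply/matrixP => i j; rewrite ord1 mxE.
by have := h i (mem_index_enum _); rewrite sqrf_eq0 => /eqP.
Qed.

Lemma sq_l2normZ m (a : R) (u : 'cV[R]_m) : sq_l2norm (a *: u) = a ^+ 2 * sq_l2norm u.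
Proof. by rewrite mulr_sumr; apply: eq_bigr => i _; rewrite mxE exprMn. Qed.

Lemma bformDl m (M : 'M[R]_m) u1 u2 v :
  bform M (u1 + u2) v = bform M u1 v + bform M u2 v.
Proof. by rewrite /bform [(u1 + u2)^T]linearD !mulmxDl mxE. Qed.

Lemma bformDr m (M : 'M[R]_m) u v1 v2 :
  bform M u (v1 + v2) = bform M u v1 + bform M u v2.
Proof. by rewrite /bform mulmxDr mxE. Qed.

Lemma bformZl m (M : 'M[R]_m) a u v : bform M (a *: u) v = a * bform M u v.
Proof.
have -> : bform M (a *: u) v = (a *: (u^T *m M *m v)) 0 0; last by rewrite mxE.
rewrite /bform (_ : (a *: u)^T = a *: u^T); last by apply/matrixP => i j; rewrite !mxE.
by rewrite -!scalemxAl.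
Qed.

Lemma bformZr m (M : 'M[R]_m) a u v : bform M u (a *: v) = a * bform M u v.
Proof. by rewrite /bform -scalemxAr mxE. Qed.

Lemma bform0l m (M : 'M[R]_m) v : bform M 0 v = 0.
Proof. by rewrite -[X in bform M X](scale0r 0) bformZl mul0r. Qed.

Lemma bform0r m (M : 'M[R]_m) u : bform M u 0 = 0.
Proof. by rewrite -[X in bform M u X](scale0r 0) bformZr mul0r. Qed.

Lemma bform_suml m (M : 'M[R]_m) (I : Type) (r : seq I) (F : I -> 'cV[R]_m) v :
  bform M (\sum_(i <- r) F i) v = \sum_(i <- r) bform M (F i) v.
Proof. exact: (big_morph (fun u => bform M u v) (fun x y => bformDl M x y v) (bform0l M v)). Qed.

Lemma bform_sumr m (M : 'M[R]_m) (I : Type) (r : seq I) (F : I -> 'cV[R]_m) u :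
  bform M u (\sum_(i <- r) F i) = \sum_(i <- r) bform M u (F i).
Proof. exact: (big_morph (bform M u) (bformDr M u) (bform0r M u)). Qed.

Lemma qformD m (M : 'M[R]_m) (u v : 'cV[R]_m) :
  qform M (u + v) = qform M u + (bform M u v + bform M v u) + qform M v.
Proof. by rewrite bformDl !bformDr !addrA. Qed.

Lemma qformE m (M : 'M[R]_m) (u : 'cV[R]_m) :
  qform M u = \sum_j \sum_l u j 0 * M j l * u l 0.
Proof.
rewrite /bform mxE exchange_big; apply: eq_bigr => l _.
by rewrite mxE mulr_suml; apply: eq_bigr => j _; rewrite mxE.
Qed.

Lemma qformZ m (M : 'M[R]_m) (a : R) (u : 'cV[R]_m) :
  qform M (a *: u) = a ^+ 2 * qform M u.
Proof. by rewrite bformZl bformZr mulrA expr2. Qed.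

Lemma qform_continuous m (M : 'M[R]_m) :
  continuous (fun v : 'rV[R]_m => qform M v^T).
Proof.
move=> v.
rewrite (_ : (fun v : 'rV[R]_m => qform M v^T) =
   fun v : 'rV[R]_m => \sum_j \sum_l v 0 j * M j l * v 0 l); last first.
  apply/funext => x; rewrite qformE; apply: eq_bigr => j _.
  by apply: eq_bigr => l _; rewrite !mxE.
apply: (@continuous_big _ _ _ _ _ _ _ _ (fun j (v : 'rV[R]_m) => \sum_l v 0 j * M j l * v 0 l)) => [|{v} j _ v].
  exact: add_continuous.
apply: (@continuous_big _ _ _ _ _ _ _ _ (fun l (v : 'rV[R]_m) => v 0 j * M j l * v 0 l)) => [|{v} l _ v].
  exact: add_continuous.
have h1 := @coord_continuous R 1 m 0 j v; have h2 := @coord_continuous R 1 m 0 l v.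
have FF : Filter (nbhs v) := nbhs_filter v.
exact: (cvgM (cvgM h1 (cvg_cst (M j l))) h2).
Qed.

Lemma rayleigh_min_attained m (M : 'M[R]_m.+1) :
  exists2 v : 'cV[R]_m.+1, sq_l2norm v = 1 &
    forall u, qform M v * sq_l2norm u <= qform M u.
Proof.
pose S := [set v : 'rV[R]_m.+1 | qform 1%:M v^T = 1].
have nE (u : 'cV[R]_m.+1) : qform 1%:M u = sq_l2norm u.
  by rewrite /bform mulmx1 sq_l2normE.
have cS : compact S.
  pose C := [set v : 'rV[R]_m.+1 | forall i, `[-1, 1]%classic (v ord0 i)].
  apply: (@subclosed_compact _ S C).
  - rewrite (_ : S = (fun v : 'rV[R]_m.+1 => qform 1%:M v^T) @^-1` [set 1])//.
    apply: preimage_closed; first by move=> x _; exact: qform_continuous.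
    exact: closed_eq.
  - apply: (@rV_compact R m.+1 (fun=> `[-1, 1]%classic)) => i.
    exact: segment_compact.
  - move=> v; rewrite /S /= nE => vS i /=; rewrite in_itv /= -ler_norml.
    have : (v 0 i) ^+ 2 <= 1.
      rewrite -vS /sq_l2norm (bigD1 i)//= mxE lerDl.
      by apply: sumr_ge0 => j _; exact: sqr_ge0.
    by rewrite -[1 in leRHS](expr1n _ 2) -[leLHS]real_normK ?num_real// ler_sqr ?nnegrE.
have S0 : S !=set0.
  exists (delta_mx 0 0); rewrite /S /= nE trmx_delta /sq_l2norm (bigD1 ord0)//= big1.
    by rewrite mxE eqxx expr1n addr0.
  by move=> i i0; rewrite mxE (negbTE i0) /= expr0n.
have cq : {within S, continuous (fun v : 'rV[R]_m.+1 => qform M v^T)}.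
  by apply: continuous_subspaceT => x; exact: qform_continuous.
have [v vS vmin] := compact_EVT_min S0 cS cq.
rewrite inE /S /= nE in vS.
exists v^T => // u.
have [/sq_l2norm_eq0 ->|u0] := eqVneq (sq_l2norm u) 0.
  by rewrite -[X in sq_l2norm X](scale0r 0) -[X in _ <= qform _ X](scale0r 0) sq_l2normZ qformZ expr0n !mul0r mulr0.
have up : 0 < sq_l2norm u by rewrite lt_neqAle eq_sym u0 sq_l2norm_ge0.
pose a := (Num.sqrt (sq_l2norm u))^-1.
have a2 : a ^+ 2 = (sq_l2norm u)^-1 by rewrite exprVn sqr_sqrtr// ltW.
have := vmin (a *: u)^T; rewrite trmxK qformZ a2.
rewrite ler_pdivlMl// mulrC; apply.
by rewrite inE /S /= trmxK nE sq_l2normZ a2 mulVf.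
Qed.

(** Let mu be the minimum of the Rayleigh quotient. The form of M - mu is
    nonnegative and vanishes at a minimiser v, which forces (M - mu) v = 0: mu is
    an eigenvalue. *)
Lemma qform_ge_eigenvalue m (M : 'M[R]_m) (c : R) : M^T = M ->
  (forall a, eigenvalue M a -> c <= a) ->
  forall u, c * sq_l2norm u <= qform M u.
Proof.
case: m M => [|m] M symM hc u.
  by rewrite /sq_l2norm /bform mxE !big_ord0 mulr0.
have [v v1 vmin] := rayleigh_min_attained M.
set mu := qform M v in vmin.
pose B := M - mu%:M.
have symB : B^T = B by rewrite linearB /= symM tr_scalar_mx.
have qB w : qform B w = qform M w - mu * sq_l2norm w.
  rewrite /bform /B mulmxBr mulmxBl [LHS]mxE [X in _ + X]mxE; congr (_ - _).
  by rewrite mul_mx_scalar -scalemxAl mxE sq_l2normE.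
have B0 w : 0 <= qform B w by rewrite qB subr_ge0.
have Bv : B *m v = 0.
  apply: sq_l2norm_eq0; set w := B *m v; set b := sq_l2norm w; set g := qform B w.
  have b0 : 0 <= b by exact: sq_l2norm_ge0.
  have g0 : 0 <= g by exact: B0.
  (* Move from the minimiser in the direction of the gradient B v. *)
  have H t : 0 <= 2 * t * b + t ^+ 2 * g.
    have := B0 (v + t *: w).
    suff -> : qform B (v + t *: w) = 2 * t * b + t ^+ 2 * g by [].
    have wv : v^T *m B = w^T by rewrite /w trmx_mul symB.
    rewrite qformD qformZ bformZl bformZr.
    have -> : bform B v w = b by rewrite /bform wv -sq_l2normE.
    have -> : bform B w v = b by rewrite /bform -mulmxA -/w -sq_l2normE.
    by rewrite qB v1 mulr1 subrr -/g; ring.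
  have := H (- (b / (g + 1))).
  have -> : 2 * - (b / (g + 1)) * b + (- (b / (g + 1))) ^+ 2 * g =
     - (b ^+ 2 * ((g + 2) / (g + 1) ^+ 2)).
    by field; rewrite gt_eqF// ltr_wpDl.
  rewrite oppr_ge0 pmulr_lle0; last by rewrite divr_gt0 ?exprn_gt0// ltr_wpDl.
  move=> h; apply/eqP; rewrite -sqrf_eq0 eq_le h; exact: sqr_ge0.
have cmu : c <= mu.
  apply: hc; apply/eigenvalueP; exists v^T.
    have : (v^T *m M)^T = (mu *: v^T)^T.
      rewrite trmx_mul trmxK symM linearZ /= trmxK.
      by apply/eqP; rewrite -subr_eq0 -[X in _ - X]mul_scalar_mx -mulmxBl Bv.
    by move=> /(congr1 trmx); rewrite !trmxK.
  apply/eqP => v0; have := v1; rewrite -[v]trmxK v0 trmx0.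
  by rewrite -[X in sq_l2norm X](scale0r 0) sq_l2normZ expr0n mul0r => /eqP; rewrite eq_sym oner_eq0.
by apply: le_trans (vmin u); rewrite ler_wpM2r// sq_l2norm_ge0.
Qed.

End quadratic_forms.

(** * Random vectors and random designs *)

Section measurable_matrices.
Context d (T : measurableType d) (m n : nat).

Lemma measurable_mx_entry i j : measurable_fun setT (fun A : 'M[T]_(m, n) => A i j).
Proof.
move=> _ B mB; rewrite setTI; apply: sub_sigma_algebra.
by exists (i, j) => //; exists B => //; rewrite setTI.
Qed.

(** The matrix sigma-algebra is generated by the preimages under the entries. *)
Lemma measurable_to_mx d' (Om : measurableType d') (f : Om -> 'M[T]_(m, n)) :
  (forall i j, measurable_fun setT (fun w => f w i j)) -> measurable_fun setT f.
Proof.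
move=> mf; apply: (@measurability _ _ _ _ _ _ (\bigcup_(ij in [set: 'I_m * 'I_n])
        preimage_set_system [set: 'M[T]_(m, n)]
          (fun A : 'M[T]_(m, n) => A ij.1 ij.2) measurable)) => //.
move=> _ [_ [[i j] _ [B mB <-]] <-]; rewrite setTI /=.
by have := mf i j measurableT B mB; rewrite setTI.
Qed.

Lemma measurable_entry d' (Om : measurableType d') (f : Om -> 'M[T]_(m, n)) i j :
  measurable_fun setT f -> measurable_fun setT (fun w => f w i j).
Proof. by move=> mf; exact: (measurableT_comp (measurable_mx_entry i j) mf). Qed.

End measurable_matrices.

Lemma measurable_row d (T : measurableType d) m n d' (Om : measurableType d')
    (f : Om -> 'M[T]_(m, n)) i :
  measurable_fun setT f -> measurable_fun setT (fun w => row i (f w)).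
Proof.
move=> mf; apply: measurable_to_mx => a j.
rewrite (_ : (fun _ => _) = fun w => f w i j); first exact: measurable_entry.
by apply/funext => w; rewrite mxE.
Qed.

Lemma measurable_mulmx (R : realType) m n p d' (Om : measurableType d')
    (f : Om -> 'M[R]_(m, n)) (g : Om -> 'M[R]_(n, p)) i j :
  measurable_fun setT f -> measurable_fun setT g ->
  measurable_fun setT (fun w => (f w *m g w) i j).
Proof.
move=> mf mg; under eq_fun do rewrite mxE.
by apply: measurable_sum => k; apply: measurable_funM; exact: measurable_entry.
Qed.

Section random_vectors.
Context d (Om : measurableType d) (R : realType) (P : probability Om R) (n : nat).
Variables (s : R) (Z : Om -> 'rV[R]_n).
Hypothesis mZ : measurable_fun setT Z.
Hypothesis sZ : subGaussian_vector P s Z.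

Lemma mgf_bounded_linear u : sq_l2norm u = 1 ->
  mgf_bounded P s (fun w => (Z w *m u) 0 0).
Proof. by move=> u1; apply: subGaussian_mgf; apply sZ.2. Qed.

Lemma sq_l2norm_delta j : sq_l2norm (delta_mx j 0 : 'cV[R]_n) = 1.
Proof.
rewrite /sq_l2norm (bigD1 j)//= mxE !eqxx expr1n big1 ?addr0// => i ij.
by rewrite mxE (negbTE ij) expr0n.
Qed.

Lemma mgf_bounded_coord j : mgf_bounded P s (fun w => Z w 0 j).
Proof.
have := mgf_bounded_linear (sq_l2norm_delta j).
rewrite (_ : (fun w => _) = fun w => Z w 0 j)//.
by apply/funext => w; rewrite -colE mxE.
Qed.

(** Needed to exchange expectation and the double sum in [second_moment]. *)
Lemma integrable_coordM j l :
  P.-integrable setT (fun w => (Z w 0 j * Z w 0 l)%:E).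
Proof.
have m_ i : measurable_fun setT (fun w => Z w 0 i) by exact: measurable_entry.
have sq i : P.-integrable setT (fun w => (Z w 0 i ^+ 2)%:E).
  apply/integrableP; split; first by apply/measurable_EFinP; exact: measurable_funX.
  apply: (@le_lt_trans _ _ (2 * (2 * expR (s ^+ 2 * 1 ^+ 2 / 2)))%:E); last exact: ltey.
  under eq_integral do rewrite abse_EFin ger0_norm ?sqr_ge0//.
  apply: (mgf_bounded_le (t := 1) (m_ i) (mgf_bounded_coord i)) => //.
  - exact: measurable_funX.
  - by move=> w; exact: sqr_ge0.
  move=> w; set z := Z w 0 i; rewrite mul1r.
  have := @expR_ge1Dxn _ `|z| 1 (normr_ge0 _).
  rewrite real_normK ?num_real// !factS fact0 /=.
  have : expR `|z| <= expR z + expR (- z).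
    by have [y0|y0] := ger0P z; rewrite ?lerDl ?lerDr expR_ge0.
  have := sqr_ge0 z; lra.
have h := integrableD measurableT (sq j) (sq l).
apply: (le_integrable measurableT _ _ h).
  by apply/measurable_EFinP; exact: measurable_funM.
move=> w _; rewrite /= lee_fin [leRHS]ger0_norm ?addr_ge0 ?sqr_ge0//.
rewrite normrM -[Z w 0 j ^+ 2]real_normK ?num_real// -[Z w 0 l ^+ 2]real_normK ?num_real//.
have := sqr_ge0 (`|Z w 0 j| - `|Z w 0 l|).
have := sqr_ge0 (`|Z w 0 j|); have := sqr_ge0 (`|Z w 0 l|).
rewrite sqrrB; lra.
Qed.

Variable Sigma : 'M[R]_n.
Hypothesis cZ : has_covariance P Z Sigma.

Lemma covariance_sym : Sigma^T = Sigma.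
Proof.
apply/matrixP => j l; rewrite mxE; apply: EFin_inj.
by rewrite -cZ -cZ covarianceC.
Qed.

Lemma integral_coordM j l :
  (\int[P]_w (Z w 0 j * Z w 0 l)%:E)%E = (Sigma j l)%:E.
Proof.
rewrite -cZ unlock !(sZ.1) /= unlock.
by apply: eq_integral => w _; congr EFin;
  change (Z w 0 j * Z w 0 l = (Z w 0 j - 0) * (Z w 0 l - 0)); rewrite !subr0.
Qed.

Lemma second_moment u :
  (\int[P]_w (((Z w *m u) 0 0) ^+ 2)%:E)%E = (qform Sigma u)%:E.
Proof.
rewrite qformE -sumEFin.
transitivity (\int[P]_w (\sum_j (\sum_l (u j 0 * u l 0)%:E * (Z w 0 j * Z w 0 l)%:E)))%E.
  apply: eq_integral => w _.
  under eq_bigr do (under eq_bigr do rewrite -EFinM; rewrite sumEFin).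
  rewrite sumEFin; congr EFin.
  rewrite mxE expr2 big_distrl /=; apply: eq_bigr => j _.
  rewrite big_distrr /=; apply: eq_bigr => l _; ring.
rewrite integral_sum//; last first.
  move=> j; apply: (integrable_sum measurableT) => l _; apply: integrableZl => //.
  exact: integrable_coordM.
apply: eq_bigr => j _; rewrite integral_sum//; last first.
  move=> l; apply: integrableZl => //; exact: integrable_coordM.
rewrite -sumEFin; apply: eq_bigr => l _.
rewrite integralZl//; last exact: integrable_coordM.
by rewrite integral_coordM -EFinM; congr EFin; ring.
Qed.

End random_vectors.

Section random_design.
Context d (Om : measurableType d) (R : realType) (P : probability Om R) (N n : nat).
Variables (s : R) (Sigma : 'M[R]_n) (X : Om -> 'M[R]_(N, n)).
Hypothesis mX : measurable_fun setT X.
Hypothesis sX : rowwise_subGaussian P s Sigma X.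

Lemma mulmx_row_entry (A : 'M[R]_(N, n)) (u : 'cV[R]_n) i :
  (row i A *m u) 0 0 = (A *m u) i 0.
Proof. by rewrite -row_mul mxE. Qed.

Lemma design_upper_tail u : sq_l2norm u = 1 ->
  (P [set w | (sq_tail s * N%:R < sq_l2norm (X w *m u))%R] <=
     (expR (- (2 * N%:R)))%:E)%E.
Proof.
move=> u1; have [[iX _] gX _] := sX.
have := @sum_sq_upper_tail _ _ _ P 'I_N _ _ (fun i w => row i (X w)) (fun _ z => (z *m u) 0 0)
  iX (fun i => measurable_row i mX) _ s.
rewrite card_ord (_ : [set w | _] = [set w | (sq_tail s * N%:R < sq_l2norm (X w *m u))%R]); last first.
  apply/funext => w /=; congr (is_true (_ < _)).
  by apply: eq_bigr => i _; rewrite mulmx_row_entry.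
apply; first by move=> i; apply: measurable_mulmx => //; exact: measurable_cst.
by move=> i; exact: mgf_bounded_linear.
Qed.

Definition fourth_bound : R := 48 * expR (1 / 2) * s ^+ 4.

Lemma design_lower_tail (c : R) u : 0 < s -> 0 < c ->
  (0 < N)%N -> (forall a, eigenvalue Sigma a -> c <= a) -> sq_l2norm u = 1 ->
  (P [set w | (sq_l2norm (X w *m u) < c / 2 * N%:R)%R] <=
     (expR (- (c ^+ 2 / (16 * fourth_bound) * N%:R)))%:E)%E.
Proof.
move=> s0 c0 N0 hc u1; have [[iX _] gX cX] := sX.
have mr i : measurable_fun setT (fun w => row i (X w)) by exact: measurable_row.
have ml i : measurable_fun setT (fun w => (row i (X w) *m u) 0 0).
  by apply: measurable_mulmx => //; exact: measurable_cst.
have := @sum_sq_lower_tail _ _ _ P 'I_N _ _ (fun i w => row i (X w)) (fun _ z => (z *m u) 0 0)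
  iX mr _ c fourth_bound c0.
rewrite card_ord (_ : [set w | _] = [set w | (sq_l2norm (X w *m u) < c / 2 * N%:R)%R]); last first.
  apply/funext => w /=; congr (is_true (_ < _)).
  by apply: eq_bigr => i _; rewrite mulmx_row_entry.
apply.
- by move=> i; apply: measurable_mulmx => //; exact: measurable_cst.
- by rewrite !mulr_gt0 ?expR_gt0// exprn_gt0.
- move=> i; rewrite (second_moment (mr i) (gX i) (cX i)) lee_fin.
  rewrite -[c]mulr1 -u1; apply: qform_ge_eigenvalue => //.
  exact: covariance_sym (cX i).
- move=> i; apply: fourth_moment_le => //.
  exact: mgf_bounded_linear.
Qed.

End random_design.

(** * The noise term *)

(** By independence the joint law is the product of the two laws, so a bound on
    the integral over [X] that is uniform in the value of [Y] integrates to the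
    same bound. *)
Lemma integral_independent_le d (Om : measurableType d) (R : realType)
    (P : probability Om R) d1 d2 (T1 : measurableType d1) (T2 : measurableType d2)
    (X : {RV P >-> T1}) (Y : {RV P >-> T2}) (f : T1 * T2 -> R) (c : R) :
  independent2 P X Y -> measurable_fun setT f -> (forall z, 0 <= f z) ->
  (forall y, (\int[P]_w (f (X w, y))%:E <= c%:E)%E) ->
  (\int[P]_w (f (X w, Y w))%:E <= c%:E)%E.
Proof.
move=> iXY mf f0 H.
have mXY : measurable_fun setT (fun w => (X w, Y w)) by exact: measurable_fun_pair.
pose Z : {mfun Om >-> (T1 * T2)%type} := mfun_Sub (mem_set mXY).
have mEf : measurable_fun [set: T1 * T2] (EFin \o f) by exact/measurable_EFinP.
have Ef0 z : (0 <= (EFin \o f) z)%E by rewrite lee_fin.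
have -> : (\int[P]_w (f (X w, Y w))%:E = \int[distribution P Z]_z (f z)%:E)%E.
  by rewrite ge0_integral_distribution.
have -> : (\int[distribution P Z]_z (f z)%:E =
    \int[(distribution P X \x distribution P Y)%E]_z (f z)%:E)%E.
  apply: eq_measure_integral => A mA _; apply/esym.
  apply: product_measure_unique => // A1 A2 mA1 mA2.
rewrite (fubini_tonelli2 _ mEf Ef0).
apply: (@le_trans _ _ (\int[distribution P Y]__ c%:E)%E).
  apply: ge0_le_integral => //.
  - by move=> y _; apply: integral_ge0.
  - exact: measurable_fun_fubini_tonelli_G.
  - move=> y _; rewrite /fubini_G ge0_integral_distribution//; first exact: H.
    by apply: (measurableT_comp mEf); exact: measurable_pair2.
rewrite integral_cst//= -[leRHS]mule1 le_eqVlt; apply/orP; left; apply/eqP.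
congr (_ * _)%E; exact: probability_setT.
Qed.

(** The noise term of the lasso, <A u, e>. *)
Definition score (R : realType) N n (u : 'cV[R]_n) (A : 'M[R]_(N, n))
    (e : 'cV[R]_N) : R := \sum_i (A *m u) i 0 * e i 0.

Section noise.
Context d (Om : measurableType d) (R : realType) (P : probability Om R) (N n : nat).
Variables (s s' : R) (Sigma : 'M[R]_n).
Variables (X : {RV P >-> 'M[R]_(N, n)}) (eps : {RV P >-> 'cV[R]_N}).
Hypothesis sX : rowwise_subGaussian P s Sigma X.
Hypothesis sE : iid_subGaussian_noise P s' eps.
Hypothesis iXE : independent2 P X eps.

Let mX : measurable_fun setT X. Proof. exact: measurable_funPT. Qed.
Let mE : measurable_fun setT eps. Proof. exact: measurable_funPT. Qed.

Lemma measurable_sq_l2norm m (f : Om -> 'cV[R]_m) : measurable_fun setT f ->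
  measurable_fun setT (fun w => sq_l2norm (f w)).
Proof.
move=> mf; apply: measurable_sum => i; apply: measurable_funX.
exact: measurable_entry.
Qed.

Lemma noise_norm_tail :
  (P [set w | (sq_tail s' * N%:R < sq_l2norm (eps w))%R] <=
     (expR (- (2 * N%:R)))%:E)%E.
Proof.
have [[iE _] gE] := sE.
have := @sum_sq_upper_tail _ _ _ P 'I_N _ _ (fun i w => eps w i 0) (fun _ z => z)
  iE (fun i => measurable_entry i 0 mE) _ s'.
rewrite card_ord; apply; first by move=> i; exact: measurable_id.
by move=> i; exact: subGaussian_mgf.
Qed.

Lemma measurable_score u : measurable_fun setT (fun w => score u (X w) (eps w)).
Proof.
apply: measurable_sum => i; apply: measurable_funM; last exact: measurable_entry.
by apply: measurable_mulmx => //; exact: measurable_cst.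
Qed.

(** For a fixed value e of the noise, the score is a sum of independent
    sub-Gaussian variables with total proxy s^2 |e|_2^2. The truncation makes
    this at most s^2 M for every e, as [integral_independent_le] requires. *)
Lemma score_mgf_le u (theta M : R) : sq_l2norm u = 1 ->
  (\int[P]_w ((sq_l2norm (eps w) <= M)%R%:R * expR (theta * score u (X w) (eps w)))%:E
     <= (expR (s ^+ 2 * theta ^+ 2 / 2 * M))%:E)%E.
Proof.
move=> u1; have [[iX _] gX _] := sX.
pose f (z : 'M[R]_(N, n) * 'cV[R]_N) : R :=
  (sq_l2norm z.2 <= M)%R%:R * expR (theta * score u z.1 z.2).
apply: (@integral_independent_le _ _ _ P _ _ _ _ X eps f) => //.
- have m2 i : measurable_fun setT (fun z : 'M[R]_(N, n) * 'cV[R]_N => z.2 i 0).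
    by apply: (measurable_entry (f := snd)); exact: measurable_snd.
  have m1 i : measurable_fun setT (fun z : 'M[R]_(N, n) * 'cV[R]_N => (z.1 *m u) i 0).
    by apply: (measurable_mulmx (f := fst)); [exact: measurable_fst | exact: measurable_cst].
  apply: measurable_funM; last first.
    apply: measurableT_comp => //; apply: measurable_funM => //.
    by apply: measurable_sum => i; apply: measurable_funM.
  pose D := [set z : 'M[R]_(N, n) * 'cV[R]_N | sq_l2norm z.2 <= M].
  rewrite (_ : (fun _ => _) = \1_D); last first.
    apply/funext => z; rewrite indicE /D; congr (nat_of_bool _)%:R.
    by apply/idP/idP; rewrite inE.
  apply: measurable_indic; rewrite (_ : D = ~` [set z | M < sq_l2norm z.2]).
    apply: measurableC; apply: measurable_gt_set.
    by apply: measurable_sum => i; exact: measurable_funX.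
  by apply/funext => z; rewrite /D /= leNgt propeqE; split => /negP.
- by move=> z; rewrite mulr_ge0// expR_ge0.
move=> e; rewrite /f /=.
have [eM|_] := boolP (sq_l2norm e <= M); last first.
  under eq_integral do rewrite mul0r.
  by rewrite integral0 lee_fin expR_ge0.
have -> : (fun w => (1%:R * expR (theta * score u (X w) e))%:E) =
   (fun w => (\prod_i expR (theta * e i 0 * (row i (X w) *m u) 0 0))%:E).
  apply/funext => w; congr EFin; rewrite mul1r -expR_sum /score mulr_sumr; congr expR.
  by apply: eq_bigr => i _; rewrite mulmx_row_entry; ring.
apply: (@le_trans _ _ (\prod_i expR (s ^+ 2 * (theta * e i 0) ^+ 2 / 2))%:E).
  apply: (@le_integral_prod_indep _ _ _ P 'I_N _ _ (fun i w => row i (X w))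
    (fun i z => expR (theta * e i 0 * (z *m u) 0 0)) _ iX) => //.
  + by move=> i; exact: measurable_row.
  + move=> i; apply: measurableT_comp => //; apply: measurable_funM => //.
    by apply: measurable_mulmx => //; exact: measurable_cst.
  + by move=> i; have := mgf_bounded_linear (gX i) u1 (theta * e i 0).
rewrite lee_fin -expR_sum ler_expR.
have -> : \sum_i s ^+ 2 * (theta * e i 0) ^+ 2 / 2 = s ^+ 2 * theta ^+ 2 / 2 * sq_l2norm e.
  by rewrite mulr_sumr; apply: eq_bigr => i _; ring.
by apply: ler_wpM2l => //; rewrite divr_ge0// mulr_ge0// sqr_ge0.
Qed.

Lemma measurable_score_event u M t :
  measurable [set w | (sq_l2norm (eps w) <= M)%R && (t < `|score u (X w) (eps w)|)%R].
Proof.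
rewrite (_ : [set w | _] = ~` [set w | M < sq_l2norm (eps w)] `&`
   [set w | t < `|score u (X w) (eps w)|]).
  apply: measurableI.
    by apply: measurableC; apply: measurable_gt_set; exact: measurable_sq_l2norm.
  apply: measurable_gt_set; apply: measurableT_comp => //; exact: measurable_score.
apply/funext => w /=; rewrite propeqE leNgt; split=> [/andP[/negP ? ?]//|[/negP ? ?]].
by apply/andP.
Qed.

Lemma score_tail u (M t : R) : sq_l2norm u = 1 -> 0 < s -> 0 < M -> 0 < t ->
  (P [set w | (sq_l2norm (eps w) <= M)%R && (t < `|score u (X w) (eps w)|)%R] <=
     (2 * expR (- (t ^+ 2 / (2 * s ^+ 2 * M))))%:E)%E.
Proof.
move=> u1 s0 M0 t0; pose th := t / (s ^+ 2 * M).
have th0 : 0 < th by rewrite divr_gt0// mulr_gt0// exprn_gt0.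
set A := [set w | _].
have mA : measurable A by exact: measurable_score_event.
pose g th w := (sq_l2norm (eps w) <= M)%R%:R * expR (th * score u (X w) (eps w)).
have g0 x w : 0 <= g x w by rewrite mulr_ge0 ?expR_ge0.
have mg x : measurable_fun setT (g x).
  apply: measurable_funM; last first.
    by apply: measurableT_comp => //; apply: measurable_funM => //; exact: measurable_score.
  rewrite (_ : (fun _ => _) = \1_(~` [set w | M < sq_l2norm (eps w)])); last first.
    apply/funext => w; rewrite indicE; congr (nat_of_bool _)%:R.
    by apply/idP/idP; rewrite inE /= leNgt => /negP.
  apply: measurable_indic; apply: measurableC; apply: measurable_gt_set.
  exact: measurable_sq_l2norm.
pose c := expR (s ^+ 2 * th ^+ 2 / 2 * M).
have -> : 2 * expR (- (t ^+ 2 / (2 * s ^+ 2 * M))) = 2 * c / expR (th * t).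
  rewrite /c -[RHS]mulrA -expRB; congr (_ * expR _); rewrite /th.
  by field; rewrite !gt_eqF.
apply: (@markov_set _ _ _ P A (fun w => g th w + g (- th) w)) => //.
- exact: expR_gt0.
- exact: measurable_funD.
- by move=> w; rewrite addr_ge0.
- move=> w /andP[h1 h2]; rewrite /g h1 !mul1r.
  have [S0|S0] := ger0P (score u (X w) (eps w)).
    rewrite ler_wpDr ?expR_ge0// ler_expR ler_pM2l// ltW//.
    by rewrite ger0_norm in h2.
  rewrite ler_wpDl ?expR_ge0// ler_expR mulNr -mulrN ler_pM2l// ltW//.
  by rewrite ltr0_norm in h2.
- under eq_integral do rewrite EFinD.
  rewrite ge0_integralD//; try by [exact/measurable_EFinP | move=> w _; rewrite lee_fin].
  rewrite mulr_natl mulr2n EFinD; apply: leeD; first exact: score_mgf_le.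
  by have := score_mgf_le (- th) M u1; rewrite sqrrN.
Qed.

End noise.

(** * Sparse approximation in quadratic forms *)

Section sparse_approximation.
Context (R : realType) (n : nat).

Definition signed_unit (p : 'I_n * bool) : 'cV[R]_n := (-1) ^+ p.2 *: delta_mx p.1 0.

(** Lists, and not sets, of signed basis vectors: sampling is with replacement,
    and the lists of length s form a finite type with (2 n)^s elements. *)
Definition signed_sum (l : seq ('I_n * bool)) : 'cV[R]_n := \sum_(p <- l) signed_unit p.

Lemma l1norm_ge0 m (v : 'cV[R]_m) : 0 <= l1norm v.
Proof. by apply: sumr_ge0 => i _. Qed.

Lemma l1norm_eq0 m (v : 'cV[R]_m) : l1norm v = 0 -> v = 0.
Proof.
move=> /eqP; rewrite psumr_eq0// => /allP h; apply/matrixP => i j; rewrite ord1 mxE.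
by have := h i (mem_index_enum _); rewrite normr_eq0 => /eqP.
Qed.

Lemma signed_unit_decomposition (v : 'cV[R]_n) :
  v = \sum_j `|v j 0| *: signed_unit (j, v j 0 < 0).
Proof.
apply/matrixP => i j; rewrite ord1 summxE (bigD1 i)//= !mxE !eqxx mulr1 big1 ?addr0.
  rewrite /=; have [v0|v0] := ltrP (v i 0) 0.
    by rewrite expr1 mulrN1 ltr0_norm// opprK.
  by rewrite expr0 mulr1 ger0_norm.
by move=> k ki; rewrite !mxE [i == k]eq_sym (negbTE ki) /= !mulr0.
Qed.

Lemma weighted_mean_ge (I : finType) (p F : I -> R) :
  (forall i, 0 <= p i) -> \sum_i p i = 1 -> exists i, F i <= \sum_i p i * F i.
Proof.
move=> p0 p1.
have [i0 _|I0] := pickP (fun _ : I => true); last first.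
  by move: p1; rewrite big_pred0// => /eqP; rewrite eq_sym oner_eq0.
have [i _ Hi] := Order.TotalTheory.arg_minP F (erefl true : xpredT i0).
exists i; rewrite -[leLHS]mul1r -p1 mulr_suml; apply: ler_sum => j _.
by rewrite ler_wpM2l// Hi.
Qed.

(** Maurey's argument without randomness. Drawing j with probability
    |v_j| / |v|_1 makes |v|_1 sign (v_j) e_j an unbiased estimate of v, and the
    right-hand side bounds the expectation of the form at w plus m independent
    draws. Choosing the draws one after the other, each no worse than the
    conditional mean, produces an actual list. *)
Lemma greedy_sparse_approximation (M : 'M[R]_n) (v : 'cV[R]_n) (b : R) :
  0 < l1norm v -> (forall j, qform M (delta_mx j 0) <= b) ->
  forall (m : nat) (w : 'cV[R]_n), exists2 l : seq ('I_n * bool), size l = m &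
    qform M (w + l1norm v *: signed_sum l) <=
    qform M w + m%:R * (bform M w v + bform M v w)
    + m%:R * (m%:R - 1) * qform M v + m%:R * (l1norm v ^+ 2 * b).
Proof.
move=> L0 hb; set L := l1norm v; have Ln0 : L != 0 by rewrite gt_eqF.
pose p j := `|v j 0| / L.
pose z j := L *: signed_unit (j, v j 0 < 0).
have p0 j : 0 <= p j by rewrite divr_ge0// ltW.
have p1 : \sum_j p j = 1 by rewrite -mulr_suml divff.
have zv : \sum_j p j *: z j = v.
  rewrite [RHS]signed_unit_decomposition; apply: eq_bigr => j _.
  by rewrite scalerA divfK.
have suml x : \sum_i p i * bform M (z i) x = bform M v x.
  transitivity (bform M (\sum_i p i *: z i) x); last by rewrite zv.
  by rewrite bform_suml; apply: eq_bigr => i _; rewrite [RHS]bformZl.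
have sumr x : \sum_i p i * bform M x (z i) = bform M x v.
  transitivity (bform M x (\sum_i p i *: z i)); last by rewrite zv.
  by rewrite bform_sumr; apply: eq_bigr => i _; rewrite [RHS]bformZr.
elim=> [|m IH] w.
  by exists [::] => //; rewrite /signed_sum big_nil scaler0 !mul0r !addr0.
pose Phi j := qform M (w + z j) + m%:R * (bform M (w + z j) v + bform M v (w + z j))
    + m%:R * (m%:R - 1) * qform M v + m%:R * (L ^+ 2 * b).
have [j hj] := weighted_mean_ge Phi p0 p1.
have [l sl hl] := IH (w + z j).
exists ((j, v j 0 < 0) :: l); first by rewrite /= sl.
have -> : w + L *: signed_sum ((j, v j 0 < 0) :: l) = w + z j + L *: signed_sum l.
  by rewrite /signed_sum big_cons scalerDr addrA.
apply: (le_trans hl); apply: (le_trans hj).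
have zb i : qform M (z i) <= L ^+ 2 * b.
  rewrite /z /signed_unit scalerA qformZ exprMn -exprM mulnC exprM sqrrN expr1n expr1n mulr1.
  by rewrite ler_wpM2l// ?sqr_ge0.
have Hz : \sum_i p i * qform M (z i) <= L ^+ 2 * b.
  rewrite -[leRHS]mul1r -p1 mulr_suml; apply: ler_sum => i _; exact: ler_wpM2l.
have -> : \sum_i p i * Phi i =
   (qform M w + m%:R * (bform M w v + bform M v w) + m%:R * (m%:R - 1) * qform M v + m%:R * (L ^+ 2 * b)) * (\sum_i p i)
   + \sum_i p i * bform M w (z i) + \sum_i p i * bform M (z i) w + \sum_i p i * qform M (z i)
   + m%:R * (\sum_i p i * bform M (z i) v) + m%:R * (\sum_i p i * bform M v (z i)).
  rewrite !mulr_sumr -!big_split /=; apply: eq_bigr => i _.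
  rewrite /Phi qformD bformDl bformDr; ring.
rewrite p1 (suml v) (suml w) (sumr v) (sumr w) -natr1 -subr_ge0.
rewrite (_ : _ - _ = L ^+ 2 * b - \sum_i p i * qform M (z i)) ?subr_ge0//.
ring.
Qed.

Lemma qform_ge_of_sparse (M : 'M[R]_n) (b : R) (s : nat) (v : 'cV[R]_n) :
  (0 < s)%N ->
  (forall l : s.-tuple ('I_n * bool), 0 <= qform M (signed_sum l)) ->
  (forall j, qform M (delta_mx j 0) <= b) ->
  - (b * l1norm v ^+ 2) <= (s%:R - 1) * qform M v.
Proof.
move=> s0 hs hb.
have [L0|L0] := eqVneq (l1norm v) 0.
  by rewrite L0 (l1norm_eq0 L0) bform0l expr0n !mulr0 oppr0.
have Lp : 0 < l1norm v by rewrite lt_neqAle eq_sym L0 l1norm_ge0.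
have [l sl] := greedy_sparse_approximation Lp hb s 0.
rewrite add0r qformZ !bform0l !bform0r addr0 mulr0 !add0r => h.
have := hs (tcast sl (in_tuple l)); rewrite val_tcast /= => h2.
have : 0 <= s%:R * ((s%:R - 1) * qform M v + l1norm v ^+ 2 * b).
  by apply: le_trans (le_trans (mulr_ge0 (sqr_ge0 (l1norm v)) h2) h) _; lra.
by rewrite pmulr_rge0 ?ltr0n//; lra.
Qed.

(** Maurey's argument applied to |X u|_2^2 / N - c |u|_2^2, which is nonnegative
    at sparse vectors and at most b at basis vectors. *)
Lemma restricted_eigenvalue_of_sparse (N : nat) (X : 'M[R]_(N, n)) (c b : R) (s : nat) :
  (1 < s)%N -> 0 <= c -> 0 <= b ->
  (forall l : s.-tuple ('I_n * bool),
     c * sq_l2norm (signed_sum l) <= N%:R^-1 * sq_l2norm (X *m signed_sum l)) ->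
  (forall j, N%:R^-1 * sq_l2norm (X *m delta_mx j 0) <= b) ->
  forall v, c * sq_l2norm v - 2 * b / s%:R * l1norm v ^+ 2 <= N%:R^-1 * sq_l2norm (X *m v).
Proof.
move=> s1 c0 b0 hs hb v.
pose M := N%:R^-1 *: (X^T *m X) - c%:M.
have ME u : qform M u = N%:R^-1 * sq_l2norm (X *m u) - c * sq_l2norm u.
  rewrite /bform /M mulmxBr mulmxBl [LHS]mxE [X in _ + X]mxE; congr (_ - _).
    by rewrite -scalemxAr -scalemxAl mxE sq_l2normE trmx_mul !mulmxA.
  by rewrite mul_mx_scalar -scalemxAl mxE sq_l2normE.
have s2 : 2 <= s%:R :> R by rewrite ler_nat.
have := @qform_ge_of_sparse M b s v (ltnW s1).
rewrite ME => H.
have {}H : - (b * l1norm v ^+ 2) <=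
    (s%:R - 1) * (N%:R^-1 * sq_l2norm (X *m v) - c * sq_l2norm v).
  apply: H => [l|j]; rewrite ME ?subr_ge0//.
  by apply: le_trans (hb j); rewrite gerBl mulr_ge0// sq_l2norm_ge0.
set q := N%:R^-1 * _ - _ in H; suff : - (2 * b / s%:R * l1norm v ^+ 2) <= q by rewrite /q; lra.
have [q0|q0] := lerP 0 q.
  by apply: le_trans q0; rewrite oppr_le0 mulr_ge0 ?sqr_ge0// divr_ge0// mulr_ge0.
have sp : 0 < s%:R :> R by lra.
rewrite (_ : - _ = - (2 * (b * l1norm v ^+ 2)) / s%:R); last by ring.
rewrite ler_pdivrMr//.
nra.
Qed.

End sparse_approximation.

(** * Graph difference operators *)

Section graph_difference.
Context (R : realType) (n : nat) (G : sgraph n).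

(** Each vertex lies on at most [maxdeg G] edges; an edge is split according to
    whether the vertex is its smaller or its larger end. *)
Lemma sum_edges_le (g : 'I_n -> R) : (forall i, 0 <= g i) ->
  \sum_(e in edges G) (g e.1 + g e.2) <= (maxdeg G)%:R * \sum_i g i.
Proof.
move=> g0; rewrite big_split /=.
have -> : \sum_(e in edges G) g e.1 = \sum_(i < n) \sum_(j < n) ((i < j)%N && G i j)%:R * g i.
  rewrite pair_big /= big_mkcond; apply: eq_bigr => -[i j] _.
  by rewrite inE /=; case: ifP; rewrite ?mul1r ?mul0r.
have -> : \sum_(e in edges G) g e.2 = \sum_(i < n) \sum_(j < n) ((j < i)%N && G i j)%:R * g i.
  rewrite exchange_big pair_big /= big_mkcond; apply: eq_bigr => -[i j] _.
  by rewrite inE /= adj_sym; case: ifP; rewrite ?mul1r ?mul0r.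
rewrite -big_split mulr_sumr /=; apply: ler_sum => i _.
rewrite -big_split /=.
apply: (@le_trans _ _ (\sum_(j < n) (G i j)%:R * g i)).
  apply: ler_sum => j _; rewrite -mulrDl ler_wpM2r// -natrD ler_nat.
  by case: ltngtP; case: (G i j).
rewrite -mulr_suml ler_wpM2r// -natr_sum ler_nat.
rewrite (_ : (\sum_(j < n) G i j)%N = #|[pred j | G i j]|); last first.
  by rewrite -sum1_card [RHS]big_mkcond; apply: eq_bigr => j _; rewrite inE; case: (G i j).
exact: (@leq_bigmax _ (fun i : 'I_n => #|[pred j | G i j]|)).
Qed.

Lemma sq_l2norm_incidence_le (v : 'cV[R]_n) :
  sq_l2norm (incidence G *m v) <= (2 * maxdeg G)%:R * sq_l2norm v.
Proof.
have -> : sq_l2norm (incidence G *m v) = \sum_(e in edges G) (v e.2 0 - v e.1 0) ^+ 2.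
  rewrite [RHS](big_enum_val (fun e : 'I_n * 'I_n => (v e.2 0 - v e.1 0) ^+ 2)) /=.
  apply: eq_bigr => r _; congr (_ ^+ 2).
  have : enum_val r \in edges G := enum_valP r.
  rewrite inE => /andP[lt12 _]; set e := enum_val r in lt12 *.
  have ne : e.2 != e.1 by apply: contraTneq lt12 => ->; rewrite ltnn.
  rewrite mxE (bigD1 e.1)//= (bigD1 e.2)//= !mxE eqxx -/e (negbTE ne) eqxx big1 ?addr0.
    by rewrite mulN1r mul1r addrC.
  by move=> i /andP[i1 i2]; rewrite mxE -/e (negbTE i1) (negbTE i2) mul0r.
apply: (@le_trans _ _ (\sum_(e in edges G) 2 * (v e.1 0 ^+ 2 + v e.2 0 ^+ 2))).
  apply: ler_sum => e _; have := sqr_ge0 (v e.1 0 + v e.2 0); rewrite sqrrB sqrrD; lra.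
rewrite -mulr_sumr natrM -mulrA ler_pM2l//.
by apply: (@sum_edges_le (fun i => v i 0 ^+ 2)) => i; exact: sqr_ge0.
Qed.

(** Cauchy-Schwarz. *)
Lemma sum_mul_sq_le (I : finType) (a b : I -> R) :
  (\sum_i a i * b i) ^+ 2 <= (\sum_i a i ^+ 2) * (\sum_i b i ^+ 2).
Proof.
set A := \sum_i a i ^+ 2; set B := \sum_i b i ^+ 2; set C := \sum_i a i * b i.
have E (x y : R) : \sum_i (x * b i - y * a i) ^+ 2 =
    x ^+ 2 * (\sum_i b i ^+ 2) - 2 * x * y * (\sum_i a i * b i) + y ^+ 2 * (\sum_i a i ^+ 2).
  by rewrite !mulr_sumr -sumrB -big_split /=; apply: eq_bigr => i _; ring.
have A0 : 0 <= A by apply: sumr_ge0 => i _; exact: sqr_ge0.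
have h : 0 <= A * (A * B - C ^+ 2).
  have -> : A * (A * B - C ^+ 2) = \sum_i (A * b i - C * a i) ^+ 2.
    by rewrite E -/A -/B -/C; ring.
  by apply: sumr_ge0 => i _; exact: sqr_ge0.
have [A1|A1] := eqVneq A 0.
  have a0 i : a i = 0.
    move: A1 => /eqP; rewrite psumr_eq0; last by move=> k _; exact: sqr_ge0.
    by move=> /allP /(_ i (mem_index_enum _)); rewrite sqrf_eq0 => /eqP.
  rewrite /C big1 ?expr0n ?mulr_ge0// => [|i _]; last by rewrite a0 mul0r.
  by apply: sumr_ge0 => i _; exact: sqr_ge0.
by rewrite -subr_ge0 -(@pmulr_rge0 _ A)// lt_neqAle eq_sym A1.
Qed.

(** |A^T w|^2 = <w, A A^T w>, and Cauchy-Schwarz cancels one factor |A^T w|. *)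
Lemma sq_l2norm_trmx_le m p (A : 'M[R]_(m, p)) (c : R) : 0 <= c ->
  (forall v : 'cV_p, sq_l2norm (A *m v) <= c * sq_l2norm v) ->
  forall w, sq_l2norm (A^T *m w) <= c * sq_l2norm w.
Proof.
move=> c0 H w; set x := A^T *m w.
have xE : sq_l2norm x = \sum_i w i 0 * (A *m x) i 0.
  rewrite sq_l2normE /x trmx_mul trmxK -mulmxA mxE.
  by apply: eq_bigr => i _; rewrite mxE.
have h : sq_l2norm x ^+ 2 <= sq_l2norm w * (c * sq_l2norm x).
  rewrite [in leLHS]xE; apply: le_trans (sum_mul_sq_le _ _) _.
  by apply: ler_wpM2l; [exact: sq_l2norm_ge0 | exact: H].
have [x0|x0] := eqVneq (sq_l2norm x) 0; first by rewrite x0 mulr_ge0// sq_l2norm_ge0.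
have xp : 0 < sq_l2norm x by rewrite lt_neqAle eq_sym x0 sq_l2norm_ge0.
by rewrite -(ler_pM2r xp) -expr2 (le_trans h)// mulrA [c * _]mulrC.
Qed.

Lemma gdiff_step_le (b : bool) (A : 'M[R]_(if b then n else #|edges G|, n)) (v : 'cV[R]_n) :
  sq_l2norm (gdiff_step A *m v) <= (2 * maxdeg G)%:R * sq_l2norm (A *m v).
Proof.
case: b A => A /=; rewrite -mulmxA; first exact: sq_l2norm_incidence_le.
by apply: sq_l2norm_trmx_le => //; exact: sq_l2norm_incidence_le.
Qed.

Lemma sq_l2norm_gdiff_le (k : nat) (v : 'cV[R]_n) :
  sq_l2norm (gdiff G k *m v) <= (2 * maxdeg G)%:R ^+ k.+1 * sq_l2norm v.
Proof.
elim: k => [|k IH] /=; first by rewrite expr1; exact: sq_l2norm_incidence_le.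
have step := gdiff_step_le (gdiff G k) v.
apply: (le_trans step); rewrite exprS -mulrA ler_wpM2l//.
Qed.

End graph_difference.

Section tuning.
Context (R : realType) (n : nat) (G : sgraph n) (k : nat).

Lemma sq_powR (a x : R) : (a `^ x) ^+ 2 = a `^ (x * 2).
Proof. by rewrite powRrM powR_mulrn// powR_ge0. Qed.

Lemma graph_tuning_ge0 (lam : R) : 0 <= lam -> 0 <= graph_tuning G k lam.
Proof. by move=> l0; rewrite /graph_tuning !mulr_ge0// powR_ge0. Qed.

Lemma graph_tuning_le (lam : R) : 0 <= lam -> graph_tuning G k lam <= lam.
Proof.
move=> l0; rewrite /graph_tuning -[leRHS]mul1r ler_wpM2r//.
have h1 : (2 : R) `^ (- (1 + k%:R / 2)) <= 1.
  rewrite -[leRHS](powRr0 2); apply: ler_powR; first by rewrite ler1n.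
  by rewrite oppr_le0 addr_ge0.
have h2 : ((maxdeg G)%:R : R) `^ (- (k.+1%:R / 2)) <= 1.
  case: (maxdeg G) => [|m].
    by rewrite powR0// oppr_eq0 mulf_neq0// ?invr_eq0 pnatr_eq0.
  rewrite -[leRHS](powRr0 m.+1%:R); apply: ler_powR; first by rewrite ler1n.
  by rewrite oppr_le0.
by rewrite -[leRHS]mulr1; apply: ler_pM => //; exact: powR_ge0.
Qed.

(** The exponents in the tuning parameter compensate the operator norm
    (2 d)^((k+1)/2), with a factor 1 / sqrt 2 to spare. *)
Lemma graph_tuning_gdiff_le (lam : R) (v : 'cV[R]_n) : 0 <= lam ->
  graph_tuning G k lam * Num.sqrt (sq_l2norm (gdiff G k *m v)) <=
  lam * Num.sqrt (sq_l2norm v).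
Proof.
move=> l0.
have g0 := graph_tuning_ge0 l0.
suff h : graph_tuning G k lam ^+ 2 * (2 * maxdeg G)%:R ^+ k.+1 <= lam ^+ 2.
  rewrite -[X in X * _ <= _]ger0_norm// -[X in _ <= X * _]ger0_norm//.
  rewrite -!sqrtr_sqr -!sqrtrM ?sqr_ge0//; apply: ler_wsqrtr.
  apply: (@le_trans _ _ (graph_tuning G k lam ^+ 2 * ((2 * maxdeg G)%:R ^+ k.+1 * sq_l2norm v))).
    by rewrite ler_wpM2l ?sqr_ge0// sq_l2norm_gdiff_le.
  by rewrite mulrA ler_wpM2r// sq_l2norm_ge0.
case: (posnP (maxdeg G)) => [->|d0].
  by rewrite muln0 mulr0n (expr0n _ k.+1) mulr0 sqr_ge0.
have dp : 0 < ((maxdeg G)%:R : R) by rewrite ltr0n.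
rewrite /graph_tuning !exprMn !sq_powR natrM exprMn !mulNr divfK ?pnatr_eq0//.
rewrite mulrDl divfK ?pnatr_eq0// [X in _ * X * _ * _]powRN powR_mulrn ?(ltW dp)//.
rewrite powRN mul1r -natrD powR_mulrn// add2n.
rewrite [2 ^+ k.+2]exprS; set T := 2 ^+ k.+1; set D := (maxdeg G)%:R ^+ k.+1.
have D0 : D != 0 by rewrite expf_neq0// gt_eqF.
have T0 : T != 0 by rewrite expf_neq0// pnatr_eq0.
rewrite (_ : _ * _ = 2^-1 * lam ^+ 2); last by field; rewrite D0 T0.
have := sqr_ge0 lam; lra.
Qed.

End tuning.

(** * Thresholding *)

Section thresholding.
Context (R : realType) (I : finType).
Implicit Types (x y v : I -> R) (S : {set I}).

Lemma card_above_threshold_le x (q r tau : R) : 0 < tau -> 0 < q ->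
  \sum_i `|x i| `^ q <= r ->
  #|[set i | tau < `|x i|]%SET|%:R <= r * tau `^ (- q).
Proof.
move=> t0 q0 hr; rewrite powRN ler_pdivlMr ?powR_gt0//; apply: le_trans hr.
rewrite -sum1_card natr_sum mulr_suml big_mkcond /=; apply: ler_sum => i _.
rewrite inE; case: ifP => [ti|_]; last exact: powR_ge0.
rewrite mul1r ge0_ler_powR ?nnegrE// ?(ltW q0)// ?(ltW t0)//; exact: ltW.
Qed.

Lemma sum_below_threshold_le x (q r tau : R) : 0 < tau -> 0 < q < 1 ->
  \sum_i `|x i| `^ q <= r ->
  \sum_(i in ~: [set i | tau < `|x i|]%SET) `|x i| <= r * tau `^ (1 - q).
Proof.
move=> t0 /andP[q0 q1] hr.
apply: (@le_trans _ _ ((\sum_i `|x i| `^ q) * tau `^ (1 - q))); last first.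
  by rewrite ler_wpM2r ?powR_ge0.
rewrite mulr_suml big_mkcond /=; apply: ler_sum => i _.
rewrite !inE -leNgt; case: ifP => [xt|_]; last by rewrite mulr_ge0 ?powR_ge0.
have [->|x0] := eqVneq (x i) 0; first by rewrite normr0 mulr_ge0 ?powR_ge0.
have p0 : 0 < `|x i| by rewrite normr_gt0.
have E : `|x i| = `|x i| `^ q * `|x i| `^ (1 - q).
  by rewrite -powRD ?(gt_eqF p0) ?implybT// addrC subrK powRr1.
rewrite [leLHS]E.
rewrite ler_wpM2l ?powR_ge0// ge0_ler_powR ?nnegrE// ?subr_ge0 ?(ltW q1)//; exact: ltW.
Qed.

(** On [S] the triangle inequality is used as |x| - |y| <= |v|, and off [S] as
    |x| - |y| <= 2 |x| - |v|. *)
Lemma l1_decrease_le x y v S : (forall i, y i - x i = v i) ->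
  \sum_i `|x i| - \sum_i `|y i| <=
  2 * \sum_(i in S) `|v i| - \sum_i `|v i| + 2 * \sum_(i in ~: S) `|x i|.
Proof.
move=> yx; have -> : v = (fun i => y i - x i) by apply/funext => i; rewrite yx.
rewrite (bigID (mem S)) /= [\sum_i `|y i|](bigID (mem S)) /= [\sum_i `|y i - x i|](bigID (mem S)) /=.
rewrite (eq_bigl (fun i => i \notin S) _ (fun i => finset.in_setC i S)).
have h1 : \sum_(i in S) `|x i| - \sum_(i in S) `|y i| <= \sum_(i in S) `|y i - x i|.
  rewrite -sumrB; apply: ler_sum => i _; rewrite distrC; exact: lerB_dist.
have h2 : \sum_(i | i \notin S) `|y i - x i| <= \sum_(i | i \notin S) `|y i| + \sum_(i | i \notin S) `|x i|.
  rewrite -big_split; apply: ler_sum => i _; exact: ler_normB.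
lra.
Qed.

Lemma sum_abs_le_sqrt_card v S :
  \sum_(i in S) `|v i| <= Num.sqrt #|S|%:R * Num.sqrt (\sum_i v i ^+ 2).
Proof.
rewrite -sqrtrM// -[leLHS]ger0_norm ?sumr_ge0// -sqrtr_sqr ler_wsqrtr//.
rewrite big_mkcond /= (eq_bigr (fun i => (i \in S)%:R * `|v i|)); last first.
  by move=> i _; case: ifP; rewrite ?mul1r ?mul0r.
apply: le_trans (sum_mul_sq_le _ _) _.
rewrite (eq_bigr (fun i => (i \in S)%:R)); last first.
  by move=> i _; case: (i \in S); rewrite ?expr1n ?expr0n.
have -> : \sum_i ((i \in S)%:R : R) = #|S|%:R.
  by rewrite -sum1_card natr_sum [RHS]big_mkcond; apply: eq_bigr => i _; case: (i \in S).
rewrite (eq_bigr (fun i => v i ^+ 2))// => i _.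
by rewrite real_normK// num_real.
Qed.

End thresholding.

(** * The lasso error on a fixed sample *)

Section lasso.
Context (R : realType) (N n : nat) (G : sgraph n) (k : nat).
Variables (X : 'M[R]_(N, n)) (b bhat : 'cV[R]_n) (e : 'cV[R]_N) (lam : R).
Hypothesis lam0 : 0 <= lam.
Hypothesis min : bhat \in lasso_argmin G k X (X *m b + e) (graph_tuning G k lam) lam.

Let v := bhat - b.
Let g := graph_tuning G k lam.

Lemma sq_l2normB m (x y : 'cV[R]_m) :
  sq_l2norm (x - y) = sq_l2norm x - 2 * (\sum_i y i 0 * x i 0) + sq_l2norm y.
Proof.
rewrite /sq_l2norm mulr_sumr -sumrB -big_split /=; apply: eq_bigr => i _.
by rewrite !mxE; ring.
Qed.

Lemma basic_inequality :
  (2 * N%:R)^-1 * sq_l2norm (X *m v) <=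
  N%:R^-1 * score v X e + g * (l1norm (gdiff G k *m b) - l1norm (gdiff G k *m bhat))
  + lam * (l1norm b - l1norm bhat).
Proof.
move: min; rewrite inE /lasso_argmin /= => /(_ b); rewrite /lasso_objective.
have -> : X *m b + e - X *m bhat = e - X *m v by rewrite /v mulmxBr opprB [X *m b + e]addrC -addrA.
have -> : X *m b + e - X *m b = e by rewrite addrC addKr.
rewrite sq_l2normB -/(score v X e) -/g invfM.
have := lam0; lra.
Qed.

Lemma score_le (t : R) : (forall j, `|score (delta_mx j 0) X e| <= t) ->
  forall u, score u X e <= t * l1norm u.
Proof.
move=> H u.
have -> : score u X e = \sum_j u j 0 * score (delta_mx j 0) X e.
  rewrite /score; under [RHS]eq_bigr do rewrite mulr_sumr.
  rewrite exchange_big /=; apply: eq_bigr => i _.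
  rewrite mxE mulr_suml; apply: eq_bigr => j _.
  by rewrite -colE mxE; ring.
rewrite mulr_sumr; apply: ler_sum => j _.
rewrite (le_trans (ler_norm _))// normrM mulrC; apply: ler_wpM2r => //.
Qed.

Variables (q1 q2 R1 R2 tau : R).
Hypothesis hq1 : 0 < q1 < 1.
Hypothesis hq2 : 0 < q2 < 1.
Hypothesis tau0 : 0 < tau.
Hypothesis hb : b \in param_space G k q1 q2 R1 R2.
Hypothesis N0 : (0 < N)%N.
Hypothesis noise : forall j, `|score (delta_mx j 0) X e| <= N%:R * (lam / 2).

(** The negative term - |v|_1 in the decrease of the sparsity penalty absorbs the
    noise term and leaves (lambda / 2) |v|_1 on the left. In the decrease of the
    graph penalty the differences off the threshold set are dropped, and the
    others are bounded through the Euclidean norm. *)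
Lemma lasso_cone :
  (2 * N%:R)^-1 * sq_l2norm (X *m v) + lam / 2 * l1norm v <=
  lam * ((2 * Num.sqrt (R2 * tau `^ (- q2)) + Num.sqrt (R1 * tau `^ (- q1))) *
           Num.sqrt (sq_l2norm v)
         + 2 * (R1 * tau `^ (1 - q1) + R2 * tau `^ (1 - q2))).
Proof.
move: hb; rewrite inE => -[hb1 hb2].
have [q10 _] := andP hq1; have [q20 _] := andP hq2.
have S1 := card_above_threshold_le tau0 q10 hb1.
have S2 := card_above_threshold_le tau0 q20 hb2.
have b1 := sum_below_threshold_le tau0 hq1 hb1.
have b2 := sum_below_threshold_le tau0 hq2 hb2.
set T1 := finset _ in S1 b1; set T2 := finset _ in S2 b2.
have Dv i : (gdiff G k *m bhat) i 0 - (gdiff G k *m b) i 0 = (gdiff G k *m v) i 0.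
  by rewrite /v mulmxBr !mxE.
have vE i : bhat i 0 - b i 0 = v i 0 by rewrite /v !mxE.
have d1 := l1_decrease_le T1 Dv.
have d2 := l1_decrease_le T2 vE.
have c1 := sum_abs_le_sqrt_card (fun i => (gdiff G k *m v) i 0) T1.
have c2 := sum_abs_le_sqrt_card (fun i => v i 0) T2.
have g0 : 0 <= g by exact: graph_tuning_ge0.
have gl : g <= lam by exact: graph_tuning_le.
have gD : g * Num.sqrt (sq_l2norm (gdiff G k *m v)) <= lam * Num.sqrt (sq_l2norm v).
  exact: graph_tuning_gdiff_le.
have bi := basic_inequality.
have sc : N%:R^-1 * score v X e <= lam / 2 * l1norm v.
  rewrite ler_pdivrMl ?ltr0n// mulrA; exact: score_le.
set x := Num.sqrt (sq_l2norm v) in gD *.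
have x0 : 0 <= x by exact: sqrtr_ge0.
have e2 : \sum_(i in T2) `|v i 0| <= Num.sqrt (R2 * tau `^ (- q2)) * x.
  by apply: (le_trans c2); rewrite ler_wpM2r// ler_wsqrtr.
have e1 : g * \sum_(i in T1) `|(gdiff G k *m v) i 0| <= lam * (Num.sqrt (R1 * tau `^ (- q1)) * x).
  apply: (@le_trans _ _ (g * (Num.sqrt (R1 * tau `^ (- q1)) * Num.sqrt (sq_l2norm (gdiff G k *m v))))).
    rewrite ler_wpM2l//; apply: (le_trans c1); rewrite ler_wpM2r ?sqrtr_ge0//.
    by rewrite ler_wsqrtr.
  by rewrite mulrCA [lam * _]mulrCA ler_wpM2l ?sqrtr_ge0.
set s1 := Num.sqrt (R1 * _) in e1 *; set s2 := Num.sqrt (R2 * _) in e2 *.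
set B1 := R1 * _ in b1 *; set B2 := R2 * _ in b2 *.
have gA : g * (l1norm (gdiff G k *m b) - l1norm (gdiff G k *m bhat)) <= lam * (s1 * x) + 2 * (lam * B1).
  have f1 : \sum_(i in T1) `|(gdiff G k *m v) i 0| <= \sum_i `|(gdiff G k *m v) i 0|.
    by rewrite [leRHS](bigID (mem T1)) /= lerDl sumr_ge0.
  have B10 : 0 <= \sum_(i in ~: T1) `|(gdiff G k *m b) i 0| by rewrite sumr_ge0.
  apply: (@le_trans _ _ (g * \sum_(i in T1) `|(gdiff G k *m v) i 0| +
    2 * (g * \sum_(i in ~: T1) `|(gdiff G k *m b) i 0|))).
    rewrite mulrCA -mulrDr ler_wpM2l//; move: d1 f1; rewrite /l1norm; lra.
  by apply: lerD => //; rewrite ler_pM2l// ler_pM.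
have lA : lam * (l1norm b - l1norm bhat) <= lam * (2 * (s2 * x) - l1norm v + 2 * B2).
  by rewrite ler_wpM2l//; move: d2 e2 b2; rewrite /l1norm; lra.
move: bi sc gA lA; lra.
Qed.

End lasso.

Lemma sq_sqrt_le (R : realType) (a b : R) : 0 <= b -> a <= b ^+ 2 -> Num.sqrt a <= b.
Proof. by move=> b0 h; rewrite -[b]ger0_norm// -sqrtr_sqr ler_wsqrtr. Qed.

(** Here x = |v|_2, z = sqrt a, l = sqrt (log n / N) |v|_1 and p = |X v|_2^2 / N.
    The first displayed hypothesis gives l <= 6 eta z x + 4 K z^2, hence
    k2 l^2 <= 72 k2 eta^2 C x^2 + O(z^2); the condition with 288 = 4 * 72 makes
    the first term at most k1 x^2 / 4, and another k1 x^2 / 4 absorbs the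
    product z x. *)
Lemma error_le_of_cone_and_curvature (R : realType) (k1 k2 al C eta K x z l p : R) :
  0 < k1 -> 0 <= k2 -> 0 < al -> 0 <= C -> 0 <= eta -> 0 <= K ->
  0 <= x -> 0 <= z -> 0 <= l -> 0 <= p -> z ^+ 2 <= C ->
  288 * k2 * eta ^+ 2 * C <= k1 ->
  p / 2 + al / 2 * l <= al * (3 * eta * z * x + 2 * K * z ^+ 2) ->
  k1 * x ^+ 2 - k2 * l ^+ 2 <= p ->
  let B0 := 2 * (32 * k2 * K ^+ 2 * C + 4 * al * K + 36 * al ^+ 2 * eta ^+ 2 / k1) / k1 in
  [/\ x ^+ 2 <= B0 * z ^+ 2,
     p <= (3 * al * eta * (1 + B0) + 4 * al * K) * z ^+ 2 &
     l ^+ 2 <= (72 * eta ^+ 2 * B0 + 32 * K ^+ 2) * (z ^+ 2) ^+ 2].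
Proof.
move=> k10 k20 al0 C0 eta0 K0 x0 z0 l0 p0 zC hC H1 H2 B0.
have lle : l <= 6 * eta * z * x + 4 * K * z ^+ 2.
  rewrite -(ler_pM2l (divr_gt0 al0 (ltr0Sn R 1))); move: H1; lra.
have ple : p <= 6 * al * eta * (z * x) + 4 * al * K * z ^+ 2.
  have : 0 <= al / 2 * l by rewrite mulr_ge0// divr_ge0// ltW.
  move: H1; lra.
have l2 : l ^+ 2 <= 72 * eta ^+ 2 * (z ^+ 2 * x ^+ 2) + 32 * K ^+ 2 * (z ^+ 2) ^+ 2.
  apply: (@le_trans _ _ ((6 * eta * z * x + 4 * K * z ^+ 2) ^+ 2)).
    by rewrite lerXn2r ?nnegrE// (le_trans l0).
  rewrite -subr_ge0 (_ : _ - _ = (6 * eta * z * x - 4 * K * z ^+ 2) ^+ 2) ?sqr_ge0//.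
  ring.
have z2 : 0 <= z ^+ 2 by exact: sqr_ge0.
have x2 : 0 <= x ^+ 2 by exact: sqr_ge0.
have l2' : k2 * l ^+ 2 <= k1 / 4 * x ^+ 2 + 32 * k2 * K ^+ 2 * C * z ^+ 2.
  apply: (le_trans (ler_wpM2l k20 l2)).
  have h1 : z ^+ 2 * x ^+ 2 <= C * x ^+ 2 by rewrite ler_wpM2r.
  have h2 : (z ^+ 2) ^+ 2 <= C * z ^+ 2 by rewrite expr2 ler_wpM2r.
  have g1 : k2 * (72 * eta ^+ 2 * (z ^+ 2 * x ^+ 2)) <= k2 * (72 * eta ^+ 2 * (C * x ^+ 2)).
    by rewrite ler_wpM2l// ler_wpM2l// mulr_ge0// sqr_ge0.
  have g2 : k2 * (32 * K ^+ 2 * (z ^+ 2) ^+ 2) <= k2 * (32 * K ^+ 2 * (C * z ^+ 2)).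
    by rewrite ler_wpM2l// ler_wpM2l// mulr_ge0// sqr_ge0.
  have g3 : 288 * k2 * eta ^+ 2 * C * x ^+ 2 <= k1 * x ^+ 2 by rewrite ler_wpM2r.
  rewrite mulrDr; move: g1 g2 g3; lra.
have amgm : 6 * al * eta * (z * x) <= k1 / 4 * x ^+ 2 + 36 * al ^+ 2 * eta ^+ 2 / k1 * z ^+ 2.
  rewrite -subr_ge0 (_ : _ - _ = (k1 * x / 2 - 6 * al * eta * z) ^+ 2 / k1).
    by rewrite divr_ge0 ?sqr_ge0// ltW.
  by field; rewrite gt_eqF.
have xB : x ^+ 2 <= B0 * z ^+ 2.
  rewrite /B0 mulrAC ler_pdivlMr//; move: H2 l2' ple amgm; lra.
have zx : z * x <= (1 + B0) / 2 * z ^+ 2.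
  have := sqr_ge0 (z - x); move: xB; rewrite sqrrB; lra.
split => //.
- apply: (le_trans ple).
  have h : 6 * al * eta * (z * x) <= 6 * al * eta * ((1 + B0) / 2 * z ^+ 2).
    by rewrite ler_wpM2l// !mulr_ge0// ltW.
  move: h; lra.
- apply: (le_trans l2).
  have h : 72 * eta ^+ 2 * (z ^+ 2 * x ^+ 2) <= 72 * eta ^+ 2 * (z ^+ 2 * (B0 * z ^+ 2)).
    by rewrite ler_wpM2l ?ler_wpM2l// mulr_ge0// sqr_ge0.
  move: h; lra.
Qed.

(** The multiple K of sqrt l that serves as threshold; enlarging it makes the
    number of entries above the threshold as small as desired. *)
Lemma exists_threshold (R : realType) (q1 q2 w : R) : 0 < q1 -> 0 < q2 -> 0 < w ->
  exists K : R, [/\ 1 <= K, K `^ (- q1) <= w & K `^ (- q2) <= w].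
Proof.
move=> q10 q20 w0.
have key q K : 0 < q -> w `^ (- q^-1) <= K -> K `^ (- q) <= w.
  move=> q0 wK; have p0 : 0 < w `^ (- q^-1) by exact: powR_gt0.
  have Kp : 0 < K := lt_le_trans p0 wK.
  rewrite powRN -[w]invrK lef_pV2 ?posrE ?invr_gt0 ?powR_gt0//.
  rewrite (_ : w^-1 = (w `^ (- q^-1)) `^ q).
    by rewrite ge0_ler_powR ?nnegrE ?(ltW q0) ?(ltW p0) ?(ltW Kp).
  by rewrite -powRrM mulNr mulVf ?gt_eqF// powR_inv1// ltW.
exists (Num.max 1 (Num.max (w `^ (- q1^-1)) (w `^ (- q2^-1)))); split.
- by rewrite le_max lexx.
- by apply: key => //; rewrite !le_max lexx !orbT.
- by apply: key => //; rewrite !le_max lexx !orbT.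
Qed.

Section powers.
Context (R : realType) (K l q : R).
Hypotheses (K1 : 1 <= K) (l0 : 0 < l) (q01 : 0 < q < 1).

Let K0 : 0 <= K. Proof. exact: le_trans K1. Qed.

Lemma threshold_powN :
  (K * Num.sqrt l) `^ (- q) = K `^ (- q) * (l `^ (1 - q / 2) / l).
Proof.
rewrite powRM ?sqrtr_ge0//; congr (_ * _).
rewrite -powR12_sqrt ?(ltW l0)// -powRrM powRD ?(gt_eqF l0) ?implybT//.
rewrite powRr1 ?(ltW l0)// mulrAC divff ?gt_eqF// mul1r; congr (_ `^ _); ring.
Qed.

Lemma threshold_pow_le :
  (K * Num.sqrt l) `^ (1 - q) <= K * (l `^ (1 - q / 2) / Num.sqrt l).
Proof.
have [q0 q1] := andP q01.
rewrite powRM ?sqrtr_ge0//.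
have -> : Num.sqrt l `^ (1 - q) = l `^ (1 - q / 2) / Num.sqrt l.
  rewrite -powR12_sqrt ?(ltW l0)// -powRrM -powRB ?(gt_eqF l0) ?implybT//.
  by congr (_ `^ _); field.
rewrite ler_wpM2r ?divr_ge0 ?powR_ge0 ?sqrtr_ge0//.
by apply: ler1_powR => //; rewrite gerBl ltW.
Qed.

Lemma sq_rate_pow : (l `^ (1 - q / 2)) ^+ 2 = l `^ (1 - q) * l.
Proof.
rewrite sq_powR -[X in _ = _ * X]powRr1 ?(ltW l0)// -powRD ?(gt_eqF l0) ?implybT//.
by congr (_ `^ _); field.
Qed.

End powers.

(** The constant depends on the curvature constants, on the multiple of sqrt l
    used for lambda and on the bound C, but not on the dimensions, the graph or
    the radii. *)
Lemma lasso_rates (R : realType) (q1 q2 k1 k2 al C : R) :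
  0 < q1 < 1 -> 0 < q2 < 1 -> 0 < k1 -> 0 < k2 -> 0 < al ->
  exists2 B : R, 0 < B &
  forall (N n k : nat) (G : sgraph n) (X : 'M[R]_(N, n)) (b bhat : 'cV[R]_n)
    (e : 'cV[R]_N) (R1 R2 l : R),
  let lam := al * Num.sqrt l in
  let a := R1 * l `^ (1 - q1 / 2) + R2 * l `^ (1 - q2 / 2) in
  let v := bhat - b in
  (0 < N)%N -> 0 < l -> 0 < R1 -> 0 < R2 -> a <= C ->
  b \in param_space G k q1 q2 R1 R2 ->
  bhat \in lasso_argmin G k X (X *m b + e) (graph_tuning G k lam) lam ->
  (forall j, `|score (delta_mx j 0) X e| <= N%:R * (lam / 2)) ->
  (forall u, k1 * sq_l2norm u - k2 * l * l1norm u ^+ 2 <= N%:R^-1 * sq_l2norm (X *m u)) ->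
  [/\ sq_l2norm v <= B * a,
     N%:R^-1 * sq_l2norm (X *m v) <= B * a &
     l1norm v ^+ 2 <= B * (R1 ^+ 2 * l `^ (1 - q1) + R2 ^+ 2 * l `^ (1 - q2))].
Proof.
move=> hq1 hq2 k10 k20 al0.
have [q10 _] := andP hq1; have [q20 _] := andP hq2.
(* C may be nonpositive, and w must be a positive number. *)
pose C' := Num.max C 1; have C'0 : 0 < C' by rewrite lt_max ltr01 orbT.
pose w := k1 / (288 * k2 * C').
have c288 : 0 < (288 : R) by rewrite ltr0n.
have w0 : 0 < w := divr_gt0 k10 (mulr_gt0 (mulr_gt0 c288 k20) C'0).
have [K [K1 Kq1 Kq2]] := exists_threshold q10 q20 w0.
have K0 : 0 <= K by exact: le_trans K1.
pose eta := Num.sqrt w; have eta0 : 0 <= eta by exact: sqrtr_ge0.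
have eta2 : eta ^+ 2 = w by rewrite sqr_sqrtr// ltW.
pose B0 := 2 * (32 * k2 * K ^+ 2 * C' + 4 * al * K + 36 * al ^+ 2 * eta ^+ 2 / k1) / k1.
have B00 : 0 <= B0.
  rewrite /B0 divr_ge0 ?(ltW k10)// mulr_ge0// !addr_ge0//.
  - by rewrite mulr_ge0 ?(ltW C'0)// mulr_ge0 ?sqr_ge0// mulr_ge0// ltW.
  - by rewrite mulr_ge0// mulr_ge0// ltW.
  - by rewrite divr_ge0 ?(ltW k10)// mulr_ge0 ?sqr_ge0// mulr_ge0 ?sqr_ge0.
pose B1 := 3 * al * eta * (1 + B0) + 4 * al * K.
have al3 m : 0 <= m%:R * al by rewrite mulr_ge0// ltW.
have B10 : 0 <= B1.
  by rewrite addr_ge0//; [exact: mulr_ge0 (mulr_ge0 (al3 3) eta0) (addr_ge0 ler01 B00) | exact: mulr_ge0].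
pose B2 := 72 * eta ^+ 2 * B0 + 32 * K ^+ 2.
have B20 : 0 <= B2 by rewrite /B2 addr_ge0// mulr_ge0 ?sqr_ge0// mulr_ge0 ?sqr_ge0.
pose B := 1 + B0 + B1 + 2 * B2.
have [B0le B1le B2le] : [/\ B0 <= B, B1 <= B & 2 * B2 <= B].
  rewrite /B; move: B00 B10 B20; generalize B0 B1 B2; clear => x y z x0 y0 z0.
  by split; lra.
exists B; first by rewrite !ltr_wpDr// ?mulr_ge0.
move=> N n k G X b bhat e R1 R2 l lam a v N0 l0 R10 R20 aC hb min noise RE.
pose r := Num.sqrt l; have r0 : 0 < r by rewrite sqrtr_gt0.
have r2 : r ^+ 2 = l by rewrite sqr_sqrtr// ltW.
pose a1 := R1 * l `^ (1 - q1 / 2); pose a2 := R2 * l `^ (1 - q2 / 2).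
have a10 : 0 <= a1 by rewrite mulr_ge0 ?powR_ge0// ltW.
have a20 : 0 <= a2 by rewrite mulr_ge0 ?powR_ge0// ltW.
have aE : a = a1 + a2 by [].
have a0 : 0 <= a by rewrite aE addr_ge0.
pose z := Num.sqrt a; have z2 : z ^+ 2 = a by rewrite sqr_sqrtr.
pose x := Num.sqrt (sq_l2norm v).
have x2 : x ^+ 2 = sq_l2norm v by rewrite sqr_sqrtr// sq_l2norm_ge0.
pose p := N%:R^-1 * sq_l2norm (X *m v).
have p0 : 0 <= p by rewrite mulr_ge0 ?invr_ge0 ?sq_l2norm_ge0.
have lam0 : 0 <= lam by rewrite mulr_ge0 ?sqrtr_ge0// ltW.
have tau0 : 0 < K * r by rewrite mulr_gt0// (lt_le_trans _ K1).
have cone := lasso_cone lam0 min hq1 hq2 tau0 hb N0 noise.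
have sle (R' q : R) : 0 < R' -> K `^ (- q) <= w -> R' * l `^ (1 - q / 2) <= a ->
    Num.sqrt (R' * (K * r) `^ (- q)) <= eta * z / r.
  move=> R'0 Kq R'a; apply: sq_sqrt_le.
    by rewrite divr_ge0 ?mulr_ge0 ?sqrtr_ge0// ltW.
  rewrite threshold_powN// !exprMn exprVn r2 eta2 z2 mulrCA -[leRHS]mulrA.
  apply: ler_pM => //; first exact: powR_ge0.
    by rewrite mulr_ge0 ?(ltW R'0)// divr_ge0 ?powR_ge0// ltW.
  by rewrite mulrA ler_pM2r ?invr_gt0.
have s1 := sle R1 q1 R10 Kq1 (eq_ind_r (fun t => a1 <= t) (ler_wpDr a20 (lexx a1)) aE).
have s2 := sle R2 q2 R20 Kq2 (eq_ind_r (fun t => a2 <= t) (ler_wpDl a10 (lexx a2)) aE).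
have ble (R' q : R) : 0 < R' -> 0 < q < 1 ->
    R' * (K * r) `^ (1 - q) <= K * (R' * l `^ (1 - q / 2)) / r.
  move=> R'0 hq; rewrite (_ : _ / r = R' * (K * (l `^ (1 - q / 2) / r))); last by ring.
  by rewrite ler_wpM2l ?(ltW R'0)//; exact: threshold_pow_le.
have b1 := ble R1 q1 R10 hq1; have b2 := ble R2 q2 R20 hq2.
have H1 : p / 2 + al / 2 * (r * l1norm v) <= al * (3 * eta * z * x + 2 * K * z ^+ 2).
  apply: (@le_trans _ _ (lam * ((2 * (eta * z / r) + eta * z / r) * x + 2 * (K * a1 / r + K * a2 / r)))).
    apply: le_trans (le_trans _ cone) _.
      by rewrite /p /lam -/r invfM; clear; lra.
    rewrite ler_wpM2l//; apply: lerD.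
      by rewrite ler_wpM2r ?sqrtr_ge0// lerD// ler_pM2l.
    by rewrite ler_pM2l// lerD.
  rewrite z2 aE /lam -/r le_eqVlt; apply/orP; left; apply/eqP; field.
  by rewrite gt_eqF.
have H2 : k1 * x ^+ 2 - k2 * (r * l1norm v) ^+ 2 <= p.
  by rewrite x2 exprMn r2 mulrA; exact: RE.
have zC : z ^+ 2 <= C' by rewrite z2 le_max aC.
have hC : 288 * k2 * eta ^+ 2 * C' <= k1.
  rewrite eta2 /w le_eqVlt; apply/orP; left; apply/eqP; field.
  by rewrite !gt_eqF.
have rl0 : 0 <= r * l1norm v by rewrite mulr_ge0 ?l1norm_ge0// ltW.
have [] := error_le_of_cone_and_curvature k10 (ltW k20) al0 (ltW C'0) eta0 K0 (sqrtr_ge0 _) (sqrtr_ge0 _) rl0 p0 zC hC H1 H2.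
rewrite -/B0 -/B1 -/B2 z2 x2 exprMn r2 => h1 h2 h3; split.
- by apply: (le_trans h1); rewrite ler_wpM2r.
- by apply: (le_trans h2); rewrite ler_wpM2r.
- rewrite -(ler_pM2l l0); apply: (le_trans h3).
  have hs : a ^+ 2 <= 2 * (l * (R1 ^+ 2 * l `^ (1 - q1) + R2 ^+ 2 * l `^ (1 - q2))).
    rewrite (_ : l * _ = a1 ^+ 2 + a2 ^+ 2).
      by rewrite aE -subr_ge0 (_ : _ - _ = (a1 - a2) ^+ 2) ?sqr_ge0//; ring.
    by rewrite !exprMn !sq_rate_pow//; ring.
  set Y := R1 ^+ 2 * _ + _ in hs *.
  have Y0 : 0 <= Y by rewrite addr_ge0// mulr_ge0 ?sqr_ge0 ?powR_ge0.
  apply: (le_trans (ler_wpM2l B20 hs)).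
  rewrite (_ : B2 * _ = l * ((2 * B2) * Y)); last by ring.
  by rewrite ler_pM2l// ler_wpM2r.
Qed.

(** * Exceptional events *)

Section union_bound.
Context d (Om : measurableType d) (R : realType) (P : probability Om R).

Lemma union_bound (I : finType) (A : I -> set Om) (p : R) :
  (forall i, measurable (A i)) -> (forall i, (P (A i) <= p%:E)%E) ->
  exists B : set Om, [/\ measurable B, (P B <= (#|I|%:R * p)%:E)%E &
    forall w, ~ B w -> forall i, ~ A i w].
Proof.
move=> mA pA; exists (\big[setU/set0]_(i <- enum I) A i); split.
- by apply: bigsetU_measurable.
- rewrite cardE; elim: (enum I) => [|i s IH]; first by rewrite big_nil measure0 mul0r.
  have mS : measurable (\big[setU/set0]_(i <- s) A i) by exact: bigsetU_measurable.
  rewrite big_cons; apply: (le_trans (measureU2 _ (mA i) mS)).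
  by rewrite /= mulrC -natr1 mulrDr mulr1 addrC EFinD mulrC; apply: leeD.
- move=> w; rewrite -bigcup_seq => nB i Aw; apply: nB.
  by exists i => //=; rewrite mem_enum.
Qed.

Lemma union_bound2 (A B : set Om) (p q : R) : measurable A -> measurable B ->
  (P A <= p%:E)%E -> (P B <= q%:E)%E -> (P (A `|` B) <= (p + q)%:E)%E.
Proof.
by move=> mA mB pA pB; apply: (le_trans (measureU2 _ mA mB)); rewrite EFinD; apply: leeD.
Qed.

End union_bound.

Section bad_events.
Context d (Om : measurableType d) (R : realType) (P : probability Om R) (N n : nat).
Variables (s s' c : R) (Sigma : 'M[R]_n).
Variables (X : {RV P >-> 'M[R]_(N, n)}).
Hypothesis s0 : 0 < s.
Hypothesis c0 : 0 < c.
Hypothesis N0 : (0 < N)%N.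
Hypothesis sX : rowwise_subGaussian P s Sigma X.

Let mX : measurable_fun setT X. Proof. exact: measurable_funPT. Qed.
Let Np : 0 < (N%:R : R). Proof. by rewrite ltr0n. Qed.

Lemma noise_event (eps : {RV P >-> 'cV[R]_N}) (t : R) :
  iid_subGaussian_noise P s' eps -> independent2 P X eps -> 0 < t ->
  exists B : set Om, [/\ measurable B,
    (P B <= (expR (- (2 * N%:R)) +
       n%:R * (2 * expR (- (t ^+ 2 / (2 * s ^+ 2 * (sq_tail s' * N%:R))))))%:E)%E &
    forall w, ~ B w -> forall j, `|score (delta_mx j 0) (X w) (eps w)| <= t].
Proof.
move=> sE iXE t0; set M := sq_tail s' * N%:R.
have M0 : 0 < M by rewrite mulr_gt0// sq_tail_gt0.
pose A (j : 'I_n) := [set w | (sq_l2norm (eps w) <= M) &&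
    (t < `|score (delta_mx j 0) (X w) (eps w)|)].
have [B [mB pB hB]] := @union_bound _ _ _ P 'I_n A _
  (fun j => measurable_score_event X eps (delta_mx j 0) M t)
  (fun j => score_tail sX iXE (sq_l2norm_delta R j) s0 M0 t0).
exists ([set w | M < sq_l2norm (eps w)] `|` B).
have m1 : measurable [set w | M < sq_l2norm (eps w)].
  by apply: measurable_gt_set; apply: measurable_sq_l2norm; exact: measurable_funPT.
split; first exact: measurableU.
- apply: union_bound2 => //; first exact: noise_norm_tail.
  by rewrite card_ord in pB.
- move=> w /not_orP[/negP h1 h2] j; rewrite leNgt; apply/negP => h.
  by apply: (hB w h2 j); rewrite /A /= leNgt h1.
Qed.

Hypothesis hc : forall a, eigenvalue Sigma a -> c <= a.

(** The exponent of [sum_sq_lower_tail] for the rows of the design. *)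
Definition lower_rate : R := c ^+ 2 / (16 * fourth_bound s).

(** The two facts about the design that Maurey's argument consumes. The lower
    tail bound is for unit vectors, hence the normalisation; a signed sum that
    cancels to 0 contributes no event. *)
Lemma sparse_design_event (sz : nat) :
  exists B : set Om, [/\ measurable B,
    (P B <= (n%:R * expR (- (2 * N%:R)) +
       (2 * n%:R) ^+ sz * expR (- (lower_rate * N%:R)))%:E)%E &
    forall w, ~ B w ->
      (forall j, N%:R^-1 * sq_l2norm (X w *m delta_mx j 0) <= sq_tail s) /\
      (forall l : sz.-tuple ('I_n * bool), c / 2 * sq_l2norm (signed_sum R l) <=
         N%:R^-1 * sq_l2norm (X w *m signed_sum R l))].
Proof.
have mXu u : measurable_fun setT (fun w => sq_l2norm (X w *m u)).
  apply: measurable_sq_l2norm; apply: measurable_to_mx => i j.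
  by apply: measurable_mulmx => //; exact: measurable_cst.
pose A1 (j : 'I_n) := [set w | sq_tail s * N%:R < sq_l2norm (X w *m delta_mx j 0)].
have [B1 [mB1 pB1 hB1]] := @union_bound _ _ _ P 'I_n A1 _
  (fun j => measurable_gt_set _ (mXu (delta_mx j 0)))
  (fun j => design_upper_tail mX sX (sq_l2norm_delta R j)).
pose unit u := (Num.sqrt (sq_l2norm u))^-1 *: u : 'cV[R]_n.
have unit1 u : sq_l2norm u != 0 -> sq_l2norm (unit u) = 1.
  by move=> u0; rewrite sq_l2normZ exprVn sqr_sqrtr ?sq_l2norm_ge0// mulVf.
pose A2 (l : sz.-tuple ('I_n * bool)) := if sq_l2norm (signed_sum R l) == 0 then set0
   else [set w | sq_l2norm (X w *m unit (signed_sum R l)) < c / 2 * N%:R].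
have mA2 l : measurable (A2 l).
  by rewrite /A2; case: ifP => // _; apply: measurable_lt_set.
have pA2 l : (P (A2 l) <= (expR (- (lower_rate * N%:R)))%:E)%E.
  rewrite /A2; case: eqVneq => [_|l0]; first by rewrite measure0 lee_fin expR_ge0.
  exact: (design_lower_tail mX sX s0 c0 N0 hc (unit1 _ l0)).
have [B2 [mB2 pB2 hB2]] := union_bound mA2 pA2.
exists (B1 `|` B2); split; first exact: measurableU.
- apply: union_bound2 => //; first by rewrite card_ord in pB1.
  rewrite (_ : (2 * n%:R) ^+ sz = #|{: sz.-tuple ('I_n * bool)}|%:R)//.
  by rewrite card_tuple card_prod card_ord card_bool natrX natrM mulrC.
- move=> w /not_orP[h1 h2]; split => [j|l].
    rewrite ler_pdivrMl// mulrC leNgt; apply/negP; exact: (hB1 w h1 j).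
  have := hB2 w h2 l; rewrite /A2; case: eqVneq => [->|l0 h].
    by move=> _; rewrite mulr0 mulr_ge0 ?invr_ge0 ?sq_l2norm_ge0// ltW.
  have {h} : c / 2 * N%:R <= sq_l2norm (X w *m unit (signed_sum R l)).
    by rewrite leNgt; apply/negP.
  rewrite /unit -scalemxAr sq_l2normZ exprVn sqr_sqrtr ?sq_l2norm_ge0//.
  have lp : 0 < sq_l2norm (signed_sum R l) by rewrite lt_neqAle eq_sym l0 sq_l2norm_ge0.
  by rewrite ler_pdivlMl// => h; rewrite ler_pdivlMl//; apply: le_trans h; lra.
Qed.

End bad_events.

Lemma expR_neg_le (R : realType) (x : R) : 0 < x -> expR (- x) <= x^-1.
Proof.
move=> x0; rewrite expRN lef_pV2 ?posrE ?expR_gt0//.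
by apply: le_trans (expR_ge1Dx x); rewrite lerDr.
Qed.

Lemma sq_l2norm_le_l1norm (R : realType) n (u : 'cV[R]_n) : sq_l2norm u <= l1norm u ^+ 2.
Proof.
rewrite expr2 {1}/l1norm mulr_suml; apply: ler_sum => i _.
rewrite -real_normK ?num_real// expr2 ler_wpM2l//.
by rewrite /l1norm (bigD1 i)//= lerDl sumr_ge0.
Qed.

Section random_restricted_eigenvalue.
Context (R : realType) (s c : R).
Hypothesis s0 : 0 < s.
Hypothesis c0 : 0 < c.

(** Maurey's argument is run with m = sparsity_rate * N / log n basis vectors,
    rounded down. Then (2 n)^m <= exp (2 m log n) <= exp (lower_rate * N / 2), so
    that the union over sparse vectors costs half of the exponent. *)
Definition sparsity_rate : R := lower_rate s c / 4.
(** Below this value of log n / N there is room for at least two basis vectors,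
    and there are at most exp N columns. *)
Definition max_ratio : R := Num.min 1 (sparsity_rate / 2).

Let rho := lower_rate s c.
Let kappa := sparsity_rate.
Let lmax := max_ratio.

Lemma lower_rate_gt0 : 0 < lower_rate s c.
Proof.
rewrite /lower_rate /fourth_bound divr_gt0 ?exprn_gt0// mulr_gt0//.
by rewrite mulr_gt0 ?exprn_gt0// mulr_gt0 ?expR_gt0.
Qed.

Let kappa0 : 0 < kappa. Proof. by rewrite divr_gt0// lower_rate_gt0. Qed.

Let lmax0 : 0 < lmax. Proof. by rewrite lt_min ltr01 divr_gt0. Qed.

Definition curvature : R := c / 2.
(** The first summand is the loss of Maurey's argument, the second one makes the
    inequality trivial when log n / N is at least max_ratio. *)
Definition tolerance : R := 4 * sq_tail s / sparsity_rate + c / (2 * max_ratio).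

Lemma tolerance_gt0 : 0 < tolerance.
Proof.
rewrite /tolerance addr_gt0//; last by rewrite divr_gt0// mulr_gt0.
by rewrite divr_gt0// mulr_gt0// sq_tail_gt0.
Qed.

(** When log n / N reaches max_ratio the empty event will do; below it, Maurey's
    argument applies off the event of [sparse_design_event]. *)
Lemma restricted_eigenvalue_event d (Om : measurableType d) (P : probability Om R) (N n : nat)
    (Sigma : 'M[R]_n) (X : {RV P >-> 'M[R]_(N, n)}) :
  (0 < N)%N -> (1 < n)%N -> rowwise_subGaussian P s Sigma X ->
  (forall a, eigenvalue Sigma a -> c <= a) ->
  exists B : set Om, [/\ measurable B,
    (P B <= (expR (- N%:R) + expR (- (rho / 2 * N%:R)))%:E)%E &
    forall w, ~ B w -> forall u,
      curvature * sq_l2norm u - tolerance * log_ratio N n * l1norm u ^+ 2 <=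
      N%:R^-1 * sq_l2norm (X w *m u)].
Proof.
move=> N0 n1 sX hc; set l := log_ratio N n.
have Np : 0 < N%:R :> R by rewrite ltr0n.
have ln0 : 0 < ln (n%:R : R) by rewrite ln_gt0// ltr1n.
have l0 : 0 < l by rewrite divr_gt0.
have lN : l * N%:R = ln n%:R by rewrite /l /log_ratio divfK// gt_eqF.
have [lbig|lsmall] := leP lmax l.
  exists set0; split => //.
    by rewrite measure0 lee_fin addr_ge0 ?expR_ge0.
  move=> w _ u; apply: (@le_trans _ _ 0); last first.
    by rewrite mulr_ge0 ?invr_ge0 ?sq_l2norm_ge0.
  rewrite subr_le0; apply: ler_pM; rewrite ?sq_l2norm_ge0 ?sq_l2norm_le_l1norm//.
    by rewrite divr_ge0// ltW.
  apply: (@le_trans _ _ (tolerance * lmax)); last by rewrite ler_pM2l// tolerance_gt0.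
  rewrite /tolerance -/kappa -/lmax mulrDl (_ : c / (2 * lmax) * lmax = curvature).
    by rewrite lerDr mulr_ge0 ?(ltW lmax0)// divr_ge0 ?(ltW kappa0)// mulr_ge0// ltW// sq_tail_gt0.
  by rewrite /curvature; field; rewrite gt_eqF.
have [l1 lk] : l < 1 /\ l < kappa / 2 by move: lsmall; rewrite /lmax /max_ratio lt_min => /andP.
pose sz := Num.truncn (kappa / l).
have kl2 : 2 < kappa / l by rewrite ltr_pdivlMr//; move: lk; lra.
have kl0 : 0 <= kappa / l by apply: ltW; apply: lt_trans kl2.
have /andP[sz1 sz2] := truncn_itv kl0; rewrite -/sz in sz1 sz2.
have sz3 : kappa / l < sz%:R + 1 by rewrite natr1.
have szn : (1 < sz)%N by rewrite -(ltr_nat R); move: kl2 sz3; lra.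
have [B [mB pB hB]] := sparse_design_event s0 c0 N0 sX hc sz.
exists B; split => //.
- apply: (le_trans pB); rewrite lee_fin; apply: lerD.
    rewrite -{1}[n%:R]lnK ?posrE ?ltr0n ?(ltnW n1)// -expRD ler_expR -lN.
    have : l * N%:R <= 1 * N%:R by rewrite ler_pM2r// ltW.
    lra.
  have n0 : (0 < n%:R :> R) by rewrite ltr0n ltnW.
  rewrite -{1}[2 * n%:R]lnK ?posrE ?mulr_gt0// -expRM_natr -expRD ler_expR.
  have h1 : ln (2 * n%:R) <= 2 * (l * N%:R) :> R.
    rewrite lnM ?posrE// lN (_ : 2 * ln n%:R = ln n%:R + ln n%:R); last by ring.
    by rewrite lerD2r ler_ln ?posrE// ler_nat.
  have h2 : ln (2 * n%:R) * sz%:R <= 2 * (l * N%:R) * (kappa / l) :> R.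
    apply: ler_pM => //; rewrite ln_ge0// -natrM ler1n muln_gt0; exact: ltnW.
  have h3 : 2 * (l * N%:R) * (kappa / l) = rho / 2 * N%:R.
    by rewrite /kappa /sparsity_rate -/rho; field; rewrite gt_eqF.
  move: h2; rewrite h3 -/rho; lra.
- move=> w /hB[h1 h2] u.
  have cv0 : 0 <= curvature by rewrite divr_ge0// ltW.
  have := restricted_eigenvalue_of_sparse szn cv0 (ltW (sq_tail_gt0 s)) h2 h1 u.
  apply: le_trans; rewrite lerD2l lerN2 ler_wpM2r ?sqr_ge0//.
  have szp : 0 < sz%:R :> R by rewrite ltr0n ltnW.
  apply: (@le_trans _ _ (4 * sq_tail s / kappa * l)); last first.
    by rewrite ler_pM2r// /tolerance -/kappa -/lmax lerDl divr_ge0 ?(ltW c0)// mulr_ge0// ltW.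
  have hs : kappa <= 2 * (sz%:R * l).
    have : kappa / l <= 2 * sz%:R by move: kl2 sz3; lra.
    by rewrite ler_pdivrMr// -mulrA.
  rewrite ler_pdivrMr// (_ : _ * l * sz%:R = 2 * sq_tail s * (2 * (sz%:R * l) / kappa)); last by ring.
  rewrite -[leLHS]mulr1; apply: ler_wpM2l.
    by apply: mulr_ge0 => //; exact: ltW (sq_tail_gt0 s).
  by rewrite ler_pdivlMr// mul1r.
Qed.

End random_restricted_eigenvalue.

(** * Asymptotics *)

Section asymptotics.
Context (R : realType) (d : nat -> measure_display) (Om : forall t, measurableType (d t)).
Variable P : forall t, probability (Om t) R.

(** One constant [B] serves for every delta: only the exceptional event shrinks. *)
Lemma le_OP_of_event (Z : forall t, Om t -> R) (a : nat -> R) (B : R) : 0 < B ->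
  (forall t, measurable_fun setT (Z t)) ->
  (forall delta, 0 < delta -> \forall t \near \oo, 0 < a t /\
     exists E : set (Om t), [/\ measurable E, (P t E <= delta%:E)%E &
       forall w, ~ E w -> 0 <= Z t w <= B * a t]) ->
  le_OP P Z a.
Proof.
move=> B0 mZ H delta delta0; exists B => //.
near=> t.
have [a0 [E [mE pE hE]]] : 0 < a t /\ exists E : set (Om t), [/\ measurable E,
    (P t E <= delta%:E)%E & forall w, ~ E w -> 0 <= Z t w <= B * a t].
  by near: t; exact: H.
apply: le_trans pE; apply: le_measure; rewrite ?inE//.
  apply: measurable_gt_set; apply: measurableT_comp => //.
  exact: measurable_funM.
move=> w /= hw; apply: contrapT => /hE/andP[Z0 ZB].
by move: hw; rewrite ger0_norm ?divr_ge0 ?(ltW a0)// ltNge ler_pdivrMr// ZB.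
Unshelve. all: by end_near.
Qed.

End asymptotics.

Lemma exceptional_probability_le (R : realType) (rho delta : R) : 0 < rho -> 0 < delta ->
  exists m : nat, forall N n : nat, (m <= N)%N -> (m <= n)%N ->
  [/\ (0 < N)%N, (1 < n)%N &
   expR (- (2 * N%:R)) + n%:R * (2 * expR (- (2 * ln n%:R))) +
   (expR (- N%:R) + expR (- (rho / 2 * N%:R))) <= delta].
Proof.
move=> rho0 delta0.
pose b := 8 / delta + 8 / (rho * delta).
have b1 : 0 < 8 / delta by rewrite divr_gt0.
have b2 : 0 < 8 / (rho * delta) by rewrite divr_gt0// mulr_gt0.
have b0 : 0 <= b by rewrite addr_ge0// ltW.
exists (Num.truncn b).+2 => N n mN mn.
have /andP[_ tb] := truncn_itv b0.
have big k : ((Num.truncn b).+2 <= k)%N -> b <= k%:R.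
  move=> mk; apply: le_trans (ltW tb) _; rewrite ler_nat; exact: ltnW.
have N0 : (0 < N)%N by exact: leq_trans mN.
have n1 : (1 < n)%N by exact: leq_trans mn.
split=> //.
have Np : 0 < N%:R :> R by rewrite ltr0n.
have np : 0 < n%:R :> R by rewrite ltr0n ltnW.
have h1 : N%:R^-1 <= delta / 8.
  rewrite -[delta / 8]invrK lef_pV2 ?posrE ?invr_gt0 ?divr_gt0// invf_div.
  by apply: le_trans (big N mN); rewrite /b lerDl ltW.
have h2 : n%:R^-1 <= delta / 8.
  rewrite -[delta / 8]invrK lef_pV2 ?posrE ?invr_gt0 ?divr_gt0// invf_div.
  by apply: le_trans (big n mn); rewrite /b lerDl ltW.
have h3 : (rho / 2 * N%:R)^-1 <= delta / 4.
  have : 8 / (rho * delta) <= N%:R by apply: le_trans (big N mN); rewrite /b lerDr ltW.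
  rewrite ler_pdivrMr ?mulr_gt0// => h.
  rewrite -[leLHS]mul1r ler_pdivrMr ?mulr_gt0 ?divr_gt0//; move: h; lra.
have e1 : expR (- (2 * N%:R)) <= N%:R^-1 :> R.
  apply: le_trans (expR_neg_le Np); rewrite ler_expR lerN2 ler_peMl// ?ler1n//.
have e2 : n%:R * (2 * expR (- (2 * ln n%:R))) = 2 * n%:R^-1 :> R.
  rewrite expRN (expRM_natl 2) lnK ?posrE//; field; by rewrite gt_eqF.
have e3 := expR_neg_le Np.
have e4 : expR (- (rho / 2 * N%:R)) <= (rho / 2 * N%:R)^-1.
  by apply: expR_neg_le; rewrite mulr_gt0// divr_gt0.
rewrite e2; move: delta0 h1 h2 h3 e1 e3 e4; clear; lra.
Qed.

Theorem theorem4 (R : realType) (k : nat) (q1 q2 sigma_eps sigma_x c c' : R)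
    (hq1 : 0 < q1 < 1) (hq2 : 0 < q2 < 1)
    (hsigma_eps : 0 < sigma_eps) (hsigma_x : 0 < sigma_x)
    (hcc' : 0 < c <= c') :
  exists2 A : R, 0 < A &
  forall (C : R) (N n : nat -> nat) (G : forall t, sgraph (n t))
    (R1 R2 lam lam_g : nat -> R)
    (d : nat -> measure_display) (Om : forall t, measurableType (d t))
    (P : forall t, probability (Om t) R)
    (X : forall t, {RV (P t) >-> 'M[R]_(N t, n t)})
    (eps : forall t, {RV (P t) >-> 'cV[R]_(N t)})
    (Sigma_x : forall t, 'M[R]_(n t))
    (beta_star : forall t, 'cV[R]_(n t))
    (y : forall t, Om t -> 'cV[R]_(N t))
    (beta_hat : forall t, {RV (P t) >-> 'cV[R]_(n t)}),
  (N t @[t --> \oo] --> \oo) ->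
  (n t @[t --> \oo] --> \oo) ->
  (forall t, 0 < R1 t /\ 0 < R2 t) ->
  (forall t, beta_star t \in param_space (G t) k q1 q2 (R1 t) (R2 t)) ->
  (forall t w, y t w = X t w *m beta_star t + eps t w) ->
  (forall t, rowwise_subGaussian (P t) sigma_x (Sigma_x t) (X t)) ->
  (forall t a, eigenvalue (Sigma_x t) a -> c <= a <= c') ->
  (forall t, iid_subGaussian_noise (P t) sigma_eps (eps t)) ->
  (forall t, independent2 (P t) (X t) (eps t)) ->
  (forall t, lam t = A * (sigma_eps * Num.sqrt (log_ratio (N t) (n t)))) ->
  (forall t, lam_g t = graph_tuning (G t) k (lam t)) ->
  (forall t, R1 t * log_ratio (N t) (n t) `^ (1 - q1 / 2)
           + R2 t * log_ratio (N t) (n t) `^ (1 - q2 / 2) <= C) ->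
  (forall t w,
     beta_hat t w \in lasso_argmin (G t) k (X t w) (y t w) (lam_g t) (lam t)) ->
  (le_OP P (fun t w => sq_l2norm (beta_hat t w - beta_star t))
      (fun t => sigma_eps ^+ 2 *
         (R1 t * log_ratio (N t) (n t) `^ (1 - q1 / 2)
          + R2 t * log_ratio (N t) (n t) `^ (1 - q2 / 2))) /\
   le_OP P
      (fun t w => (N t)%:R^-1 *
         sq_l2norm (X t w *m (beta_hat t w - beta_star t)))
      (fun t => sigma_eps ^+ 2 *
         (R1 t * log_ratio (N t) (n t) `^ (1 - q1 / 2)
          + R2 t * log_ratio (N t) (n t) `^ (1 - q2 / 2)))) /\
  le_OP P (fun t w => l1norm (beta_hat t w - beta_star t) ^+ 2)
      (fun t => sigma_eps ^+ 2 *
         (R1 t ^+ 2 * log_ratio (N t) (n t) `^ (1 - q1)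
          + R2 t ^+ 2 * log_ratio (N t) (n t) `^ (1 - q2))).
Proof.
have [c0 _] := andP hcc'.
pose M := sq_tail sigma_eps; have M0 : 0 < M by exact: sq_tail_gt0.
(* With lambda = al * sqrt (log n / N) the exponent of [score_tail] at level
   N lambda / 2 is exactly 2 log n, twice what the union over columns costs. *)
pose al := 4 * sigma_x * Num.sqrt M.
have al0 : 0 < al by rewrite mulr_gt0 ?sqrtr_gt0// mulr_gt0.
exists (al / sigma_eps); first by rewrite divr_gt0.
move=> C N n G R1 R2 lam lam_g d Om P X eps Sigma b y bhat.
move=> cvN cvn hR hb hy hX hS hE hXE hlam hlamg hC hmin.
have k10 : 0 < curvature c by rewrite divr_gt0.
have k20 : 0 < tolerance sigma_x c by exact: tolerance_gt0.
have [B B0 rates] := lasso_rates C hq1 hq2 k10 k20 al0.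
pose l t := log_ratio (N t) (n t) : R.
pose a t := R1 t * l t `^ (1 - q1 / 2) + R2 t * l t `^ (1 - q2 / 2).
pose a' t := R1 t ^+ 2 * l t `^ (1 - q1) + R2 t ^+ 2 * l t `^ (1 - q2).
pose v t w := bhat t w - b t.
have lamE t : lam t = al * Num.sqrt (l t).
  by rewrite hlam /l; field; rewrite gt_eqF.
have good delta : 0 < delta -> \forall t \near \oo, 0 < l t /\
    exists E : set (Om t), [/\ measurable E, (P t E <= delta%:E)%E &
      forall w, ~ E w -> [/\ sq_l2norm (v t w) <= B * a t,
         (N t)%:R^-1 * sq_l2norm (X t w *m v t w) <= B * a t &
         l1norm (v t w) ^+ 2 <= B * a' t]].
  move=> delta0.
  have [m hm] := exceptional_probability_le (lower_rate_gt0 hsigma_x c0) delta0.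
  near=> t.
  have mN : (m <= N t)%N by near: t; exact: (cvgnyPge _).1.
  have mn : (m <= n t)%N by near: t; exact: (cvgnyPge _).1.
  have [N0 n1 pb] := hm _ _ mN mn.
  have Np : 0 < (N t)%:R :> R by rewrite ltr0n.
  have ln0 : 0 < ln ((n t)%:R : R) by rewrite ln_gt0// ltr1n.
  have l0 : 0 < l t by rewrite divr_gt0.
  split=> //.
  have lam0 : 0 < lam t by rewrite lamE mulr_gt0// sqrtr_gt0.
  have t0 : 0 < (N t)%:R * (lam t / 2) by rewrite mulr_gt0// divr_gt0.
  have [E1 [mE1 pE1 hE1]] := noise_event hsigma_x N0 (hX t) (hE t) (hXE t) t0.
  have [E2 [mE2 pE2 hE2]] := restricted_eigenvalue_event hsigma_x c0 N0 n1 (hX t)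
     (fun x hx => proj1 (andP (hS t x hx))).
  exists (E1 `|` E2); split; first exact: measurableU.
    apply: (le_trans (union_bound2 mE1 mE2 pE1 pE2)); rewrite lee_fin.
    apply: le_trans pb; rewrite (_ : _ / _ = 2 * ln (n t)%:R)//.
    have -> : ln (n t)%:R = l t * (N t)%:R by rewrite /l /log_ratio divfK// gt_eqF.
    have sl : Num.sqrt (l t) ^+ 2 = l t by rewrite sqr_sqrtr// ltW.
    have sM : Num.sqrt M ^+ 2 = M by rewrite sqr_sqrtr// ltW.
    rewrite -/M lamE /al -[in RHS]sl -[X in _ / (_ * (X * _))]sM.
    by field; rewrite !gt_eqF// sqrtr_gt0.
  move=> w /not_orP[w1 w2].
  apply: (rates _ _ k (G t) (X t w) (b t) (bhat t w) (eps t w) (R1 t) (R2 t) (l t)) => //.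
  - exact: (hR t).1.
  - exact: (hR t).2.
  - by have := hmin t w; rewrite hy hlamg lamE.
  - by move=> j; have := hE1 w w1 j; rewrite lamE.
  - exact: hE2.
have mv t : measurable_fun setT (v t).
  apply: measurable_to_mx => i j.
  rewrite (_ : (fun _ => _) = fun w => bhat t w i j - b t i j).
    by apply: measurable_funB => //; apply: measurable_entry; exact: measurable_funPT.
  by apply/funext => w; rewrite !mxE.
have s20 : 0 < sigma_eps ^+ 2 by exact: exprn_gt0.
have Bs0 : 0 < B / sigma_eps ^+ 2 by rewrite divr_gt0.
have BE x : B / sigma_eps ^+ 2 * (sigma_eps ^+ 2 * x) = B * x.
  by field; rewrite gt_eqF.
have a0 t : 0 < l t -> 0 < a t.
  by move=> l0; rewrite addr_gt0// mulr_gt0 ?powR_gt0//; [exact: (hR t).1|exact: (hR t).2].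
have a'0 t : 0 < l t -> 0 < a' t.
  by move=> l0; rewrite addr_gt0// mulr_gt0 ?powR_gt0// exprn_gt0//; [exact: (hR t).1|exact: (hR t).2].
split; [split|]; apply: (le_OP_of_event Bs0).
- by move=> t; exact: measurable_sq_l2norm.
- move=> delta /good; apply: filterS => t [l0 [E [mE pE hE']]].
  split; first by rewrite mulr_gt0// a0.
  exists E; split=> // w /hE'[h _ _].
  by rewrite sq_l2norm_ge0 /= BE.
- move=> t; apply: measurable_funM => //; apply: measurable_sq_l2norm.
  apply: measurable_to_mx => i j; apply: measurable_mulmx => //; exact: measurable_funPT.
- move=> delta /good; apply: filterS => t [l0 [E [mE pE hE']]].
  split; first by rewrite mulr_gt0// a0.
  exists E; split=> // w /hE'[_ h _].
  by rewrite mulr_ge0 ?invr_ge0 ?sq_l2norm_ge0 //= BE.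
- move=> t; apply: measurable_funX; apply: measurable_sum => i.
  by apply: measurableT_comp => //; exact: measurable_entry.
- move=> delta /good; apply: filterS => t [l0 [E [mE pE hE']]].
  split; first by rewrite mulr_gt0// a'0.
  exists E; split=> // w /hE'[_ _ h].
  by rewrite sqr_ge0 /= BE.
Unshelve. all: by end_near.
Qed.
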